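(* Let $d\ge 1$ and let $\Omega\subset\mathbb{R}^d$ be a bounded open convex set with Lipschitz boundary such that $\vec 0\in \mathrm{int}(\Omega)$ and $\pm\vec e_i\in\overline{\Omega}$ for $1\le i\le d$. (i) Let $0\leq \beta <d$ and $0 \leq \alpha \leq 1$. Let $q \geq 1$ be such that $$q > \frac{d}{d - \beta + \alpha}.$$ Then there exists a constant $C = C(d,\Omega,\alpha,\beta,q) >0$ such that $$\|\nabla M_{\Omega,\beta}f\|_{\ell^q(\mathbb{Z}^d)} \leq C\,\|\nabla f\|_{\ell^1(\mathbb{Z}^d)}^{1-\alpha}\,\|f\|^{\alpha}_{\ell^{1}(\mathbb{Z}^{d})}\qquad \forall f\in \ell^{1}(\mathbb{Z}^{d}).$$ Moreover, the operator $f\mapsto \nabla M_{\Omega,\beta}f$ is continuous from $\ell^{1}(\mathbb{Z}^d)$ to $\ell^{q}(\mathbb{Z}^{d})$. (ii) Let $1\leq \beta <d$ and $0 \leq \alpha < 1$. Let $$q = \frac{d}{d - \beta + \alpha}.$$ Then there exists a constant $C = C(d,\Omega,\alpha,\beta) >0$ such that $$\|\nabla M_{\Omega,\beta}f\|_{\ell^q(\mathbb{Z}^d)} \leq C\,\|\nabla f\|_{\ell^1(\mathbb{Z}^d)}^{1-\alpha}\,\|f\|^{\alpha}_{\ell^{1}(\mathbb{Z}^{d})}\qquad \forall f\in \ell^{1}(\mathbb{Z}^{d}).$$ Moreover, the operator $f\mapsto \nabla M_{\Omega,\beta}f$ is continuous from $\ell^{1}(\mathbb{Z}^d)$ to $\ell^{q}(\mathbb{Z}^{d})$.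 The same results (both (i) and (ii), boundedness and continuity) hold with the discrete uncentered fractional maximal operator $\widetilde{M}_{\Omega,\beta}$ in place of $M_{\Omega,\beta}$.
   Context: Functions are real-valued on $\mathbb{Z}^d$; $\vec e_i$ is the $i$-th canonical basis vector of $\mathbb{R}^d$. For $r>0$ and $\vec x_0\in\mathbb{R}^d$ set $\overline\Omega_{r}(\vec{x}_{0}) =\{\vec{x} \in\mathbb{R}^{d}: r^{-1}(\vec{x}-\vec{x}_{0})\in \overline{\Omega}\}$, and set $\overline\Omega_{0}(\vec{x}_{0}) =\{\vec{x}_{0}\}$; write $\overline\Omega_r=\overline\Omega_r(\vec 0)$. Let $N(\vec x,r)$ be the number of lattice points (points of $\mathbb{Z}^d$) in $\overline\Omega_r(\vec x)$ and $N(r)=N(\vec 0,r)$. For $0\le\beta<d$ and $f:\mathbb{Z}^d\to\mathbb{R}$, the discrete centered fractional maximal operator associated to $\Omega$ is $$M_{\Omega, \beta}f(\vec n)=\sup_{r\geq 0} \frac{1}{N(r)^{1- \frac{\beta}{d}}}\,\sum_{\vec m\in \overline\Omega_{r}\cap\mathbb{Z}^d }|f(\vec n+\vec m)|,$$ and the uncentered version is $$\widetilde{M}_{\Omega,\beta}f(\vec n)=\sup_{\overline\Omega_{r}(\vec x_{0}) \ni \vec n}\, \frac{1}{N(\vec x_{0},r)^{1-\frac{\beta}{d}}}\,\sum_{\vec m\in \overline\Omega_{r}(\vec x_{0})\cap\mathbb{Z}^d }|f( \vec m)|,$$ the supremum being over all $\vec x_0\in\mathbb{R}^d$ and $r\ge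 0$ with $\vec n\in\overline\Omega_r(\vec x_0)$. The discrete gradient is $\nabla f(\vec n)=\big(\tfrac{\partial f}{\partial x_1}(\vec n),\ldots,\tfrac{\partial f}{\partial x_d}(\vec n)\big)$ with $\tfrac{\partial f}{\partial x_i}(\vec n)=f(\vec n+\vec e_i)-f(\vec n)$. For a scalar- or vector-valued function $g$ on $\mathbb{Z}^d$ and $1\le p<\infty$, $\|g\|_{\ell^p(\mathbb{Z}^d)}=\big(\sum_{\vec n\in\mathbb{Z}^d}|g(\vec n)|^p\big)^{1/p}$, with $|\cdot|$ the absolute value or Euclidean norm. When $\alpha=0$ or $\alpha=1$, the factor with exponent $0$ on the right-hand side is understood to be absent (equal to $1$). *)

(* Defs.v *)
From HB Require Import structures.
From mathcomp Require Import all_boot all_order all_algebra finmap.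
From mathcomp Require Import all_classical all_reals all_analysis.

Set Implicit Arguments.
Unset Strict Implicit.
Unset Printing Implicit Defensive.

Import Order.TTheory GRing.Theory Num.Theory.
Import numFieldNormedType.Exports.

Local Open Scope classical_set_scope.
Local Open Scope ring_scope.

(** Ω has Lipschitz boundary: near each of its boundary points, and after an
    orthogonal change of coordinates [x |-> x *m P], Ω is the part of space
    lying strictly above the graph of a Lipschitz function of the coordinates
    other than the [i]-th one, the [i]-th one being the vertical coordinate
    ([col' i] deletes the [i]-th entry of a row vector). *)
Definition lipschitz_boundary (R : realType) (d : nat)
    (Omega : set 'rV[R]_d) : Prop :=
  forall p : 'rV[R]_d, (closure Omega `\` Omega°) p ->
    exists (P : 'M[R]_d) (i : 'I_d) (phi : 'rV[R]_d.-1 -> R^o),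
      [/\ P *m P^T = 1%:M,
          [lipschitz phi x | x in setT] &
          \forall x \near p,
            Omega x <-> phi (col' i (x *m P)) < (x *m P) 0 i].

Definition lattice_embed (R : realType) (d : nat) (n : 'rV[int]_d) : 'rV[R]_d :=
  map_mx intr n.

Definition dilate (R : realType) (d : nat) (Omega : set 'rV[R]_d)
    (x0 : 'rV[R]_d) (r : R) : set 'rV[R]_d :=
  if r == 0 then [set x0] else [set x | closure Omega (r^-1 *: (x - x0))].

Definition lattice_points (R : realType) (d : nat) (Omega : set 'rV[R]_d)
    (x0 : 'rV[R]_d) (r : R) : set 'rV[int]_d :=
  [set m | dilate Omega x0 r (lattice_embed R m)].

(** [fset_set] is the given set as a finite set when it is finite, which is the
    case of [lattice_points Omega x0 r] as soon as Ω is bounded. *)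
Definition lattice_count (R : realType) (d : nat) (Omega : set 'rV[R]_d)
    (x0 : 'rV[R]_d) (r : R) : nat :=
  #|` fset_set (lattice_points Omega x0 r)|.

(** In the two definitions below, the sums run over finite sets when Ω is
    bounded.  Moreover [sup] is the real-valued supremum; when f is in ℓ^1 and
    0 <= beta < d, the sets are nonempty and bounded above by the ℓ^1 norm of f
    (each counting factor being at least 1), so that it is the actual
    supremum. *)
Definition centered_maximal (R : realType) (d : nat) (Omega : set 'rV[R]_d)
    (beta : R) (f : 'rV[int]_d -> R) (n : 'rV[int]_d) : R :=
  sup [set ((lattice_count Omega 0 r)%:R `^ (1 - beta / d%:R))^-1 *
           \sum_(m \in lattice_points Omega 0 r) `|f (n + m)|
      | r in [set r : R | 0 <= r]].

Definition uncentered_maximal (R : realType) (d : nat) (Omega : set 'rV[R]_d)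
    (beta : R) (f : 'rV[int]_d -> R) (n : 'rV[int]_d) : R :=
  sup [set ((lattice_count Omega xr.1 xr.2)%:R `^ (1 - beta / d%:R))^-1 *
           \sum_(m \in lattice_points Omega xr.1 xr.2) `|f m|
      | xr in [set xr : 'rV[R]_d * R |
                0 <= xr.2 /\ dilate Omega xr.1 xr.2 (lattice_embed R n)]].

Definition dgrad (R : realType) (d : nat) (f : 'rV[int]_d -> R)
    (n : 'rV[int]_d) : 'rV[R]_d :=
  \row_i (f (n + delta_mx 0 i) - f n).

(** The norm of the library on row vectors is the sup norm. *)
Definition eucl_norm (R : realType) (d : nat) (v : 'rV[R]_d) : R :=
  Num.sqrt (\sum_i v 0 i ^+ 2).

(** Extended real-valued, [+oo] exactly when g is not in ℓ^p (for p > 0). *)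
Definition lpnorm (R : realType) (d : nat) (p : R) (g : 'rV[int]_d -> R) : \bar R :=
  poweR (\esum_(n in [set: 'rV[int]_d]) (`|g n| `^ p)%:E)%E p^-1.

Definition lpnormv (R : realType) (d : nat) (p : R)
    (g : 'rV[int]_d -> 'rV[R]_d) : \bar R :=
  lpnorm p (fun n => eucl_norm (g n)).

Definition in_l1 (R : realType) (d : nat) (f : 'rV[int]_d -> R) : Prop :=
  (lpnorm 1 f < +oo)%E.

(** [poweR x 0 = 1] for all [x], so a factor with exponent 0 is absent. *)
Definition grad_bounded (R : realType) (d : nat)
    (T : ('rV[int]_d -> R) -> 'rV[int]_d -> R) (alpha q : R) : Prop :=
  exists2 C : R, 0 < C &
    forall f : 'rV[int]_d -> R, in_l1 f ->
      (lpnormv q (dgrad (T f)) <=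
         C%:E * (poweR (lpnormv 1 (dgrad f)) (1 - alpha) *
                 poweR (lpnorm 1 f) alpha))%E.

Definition grad_continuous (R : realType) (d : nat)
    (T : ('rV[int]_d -> R) -> 'rV[int]_d -> R) (q : R) : Prop :=
  forall f : 'rV[int]_d -> R, in_l1 f ->
  forall eps : R, 0 < eps -> exists2 delta : R, 0 < delta &
    forall g : 'rV[int]_d -> R, in_l1 g ->
      (lpnorm 1 (fun n => g n - f n)%R < delta%:E)%E ->
      (lpnormv q (fun n => dgrad (T g) n - dgrad (T f) n)%R < eps%:E)%E.

(* Main.v *)
Require Import Defs.
From HB Require Import structures.
From mathcomp Require Import all_boot all_order all_algebra finmap.
From mathcomp Require Import all_classical all_reals all_analysis.
From mathcomp Require Import zify ring lra.
Set Implicit Arguments.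
Unset Strict Implicit.
Unset Printing Implicit Defensive.
Import Order.TTheory GRing.Theory Num.Theory.
Import numFieldNormedType.Exports.
Local Open Scope classical_set_scope.
Local Open Scope ring_scope.

(** The discrete gradient of a maximal function [M f] is controlled pointwise
    by sums of [|f|] and of its gradient over boxes.  Let a dilate of radius
    [r] almost attain the supremum at [n], and let [n'] be a neighbour of [n]
    with [M f n' < M f n].  Since the unit vectors lie in the closure of
    [Omega], the dilate of radius [r + 1] is available at [n'] and contains the
    first one; its number of lattice points is larger by at most the order of
    [r^(d-1)], because by convexity a walk along a lattice direction pointing
    away from the centre leaves the annulus between the two dilates at its
    first step ([annulus_exit], [annulus_card]).  So [M f n - M f n'] is at
    most of the order [r^(- (d - beta + 1))] times the sum of [|f|] over the
    dilate.  Comparing with the translated dilate instead, it is at most of the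
    order [r^(- (d - beta))] times the sum of the gradient.  Both hold with the
    same radius ([family_gradient_bound]), for the centered and the uncentered
    operators alike.

    The rest takes place on the lattice.  Let [a] and [b] be the l^1 norms of
    the gradient and of [f]; all bounds are proved in the form [lam^alpha a +
    lam^(alpha - 1) b] for every [lam > 0], which becomes [a^(1 - alpha)
    b^alpha] at [lam = b / a].

    If [q > d / (d - beta + alpha)], the gradient is used for radii below [lam]
    and [f] itself for radii above; in both cases the kernel [|n|^(- (d - beta
    + alpha))] remains, which is in l^q ([subcritical_bound]).

    If [q = d / (d - beta + alpha)], [beta >= 1] and [alpha < 1], this kernel
    just fails to be in l^q, and [|grad (M f)|] is bounded by the fractional
    maximal function of order [beta - 1] of [f], which is sublinear.  By layers
    it is enough to treat the indicator of a finite set [E].  There the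
    Hardy-Littlewood maximal theorem gives a bound by a power of [|E|]
    ([restricted_fractional]), and the isoperimetric inequality
    ([isoperimetric]) turns part of this power into the perimeter of [E]
    ([critical_bound]).

    Continuity holds as soon as [q > d / (d - beta + 1)], thus in both cases.
    The operator [M] is Lipschitz from l^1 to the bounded functions, so that
    gradients converge pointwise; by the bound with [alpha = 1] the l^q mass of
    [grad (M g)] far from the bulk of [f] is small, uniformly for [g] close to
    [f] ([continuity_of_domination]). *)

(** * Powers and finite sums *)

Section FinSums.
Variables (R : realType) (T : choiceType).
Implicit Types (F G E : {fset T}) (g h a : T -> R).

Lemma fsum_mem_cond F G g : {subset F <= G} ->
  \sum_(n <- F) g n = \sum_(n <- G | n \in F) g n.
Proof.
move=> FG; rewrite [RHS]big_fset_condE; apply: eq_fbigl => x; rewrite !inE /= andbC.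
by case: (boolP (x \in F)) => //= xF; rewrite FG.
Qed.

Lemma fsum_le_sub F G g : (forall n, 0 <= g n) -> {subset F <= G} ->
  \sum_(n <- F) g n <= \sum_(n <- G) g n.
Proof.
move=> g0 FG; rewrite (fsum_mem_cond g FG) [leRHS](bigID (fun n => n \in F)) /=.
by rewrite lerDl sumr_ge0.
Qed.

Lemma ler_fsum F g h : (forall n, n \in F -> g n <= h n) ->
  \sum_(n <- F) g n <= \sum_(n <- F) h n.
Proof. by move=> gh; rewrite big_seq [leRHS]big_seq; exact: ler_sum. Qed.

Lemma fsum1E F : \sum_(n <- F) (1 : R) = #|` F|%:R.
Proof. by rewrite big_const_seq count_predT iter_addr_0. Qed.
End FinSums.

Lemma powRN_le (R : realType) (x y s : R) : 0 < x -> x <= y -> 0 <= s ->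
  y `^ (- s) <= x `^ (- s).
Proof.
move=> x0 xy s0; have y0 := lt_le_trans x0 xy.
by rewrite !powRN lef_pV2 ?posrE ?powR_gt0 // ge0_ler_powR // nnegrE ltW.
Qed.

Lemma powR_le (R : realType) (x y s : R) : 0 <= x -> x <= y -> 0 <= s ->
  x `^ s <= y `^ s.
Proof.
by move=> x0 xy s0; apply: ge0_ler_powR; rewrite // nnegrE // (le_trans x0).
Qed.

Lemma powRDp (R : realType) (x r s : R) : 0 < x ->
  x `^ (r + s) = x `^ r * x `^ s.
Proof. by move=> x0; rewrite powRD // (gt_eqF x0) implybT. Qed.

Lemma powR_split (R : realType) (x q : R) : 0 <= x -> 1 <= q ->
  x `^ q = x `^ (q - 1) * x.
Proof. by move=> x0 q1; rewrite mulrC mulr_powRB1 // (lt_le_trans ltr01). Qed.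

Lemma powR_add_le (R : realType) (x y q : R) : 0 <= x -> 0 <= y -> 0 <= q ->
  (x + y) `^ q <= 2 `^ q * (x `^ q + y `^ q).
Proof.
move=> x0 y0 q0; wlog xy : x y x0 y0 / x <= y.
  by move=> H; have [/H|/ltW/H] := leP x y; [|rewrite addrC (addrC (y `^ q))];
    apply.
have : (x + y) `^ q <= (2 * y) `^ q.
  by apply: powR_le; rewrite ?addr_ge0 //; lra.
move=> /le_trans; apply; rewrite powRM // ler_wpM2l ?powR_ge0 //.
by rewrite lerDr powR_ge0.
Qed.

Lemma powR_invl (R : realType) (x s : R) : 0 <= x -> x^-1 `^ s = (x `^ s)^-1.
Proof. by move=> x0; rewrite -powR_inv1 // -powRrM mulN1r powRN. Qed.

Lemma powR_lt1 (R : realType) (x s : R) : 0 <= x -> x < 1 -> 0 < s ->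
  x `^ s < 1.
Proof.
move=> x0 x1 s0; have <- : 1 `^ s = 1 :> R by rewrite powR1.
by apply: gt0_ltr_powR; rewrite // nnegrE.
Qed.

Lemma powR_ge1 (R : realType) (x s : R) : 1 <= x -> 0 <= s -> 1 <= x `^ s.
Proof.
move=> x1 s0; have <- : 1 `^ s = 1 :> R by rewrite powR1.
by apply: powR_le.
Qed.

Lemma powR_le1 (R : realType) (x s : R) : 0 <= x -> x <= 1 -> 0 <= s ->
  x `^ s <= 1.
Proof.
move=> x0 x1 s0; have <- : 1 `^ s = 1 :> R by rewrite powR1.
by apply: powR_le.
Qed.

Section WeakStrong.
Variables (R : realType) (T : choiceType).

(** By the weak-type bound at most [2 W / A] terms exceed [A / 2], and they
    contribute at most [2 W A^(s-1)]; the others satisfy the same hypotheses with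
    [A / 2] for [A].  As [s > 1], the contributions of the successive halvings
    form a convergent geometric series.  By the choice of [J] about
    [J] halvings exhaust the nonzero terms. *)
Lemma sum_powR_halving (s : R) (a : T -> R) (W : R) : 1 < s -> 0 <= W ->
  (forall n, 0 <= a n) -> forall (J : nat) (F : seq T) (A : R), 0 < A ->
  (forall n, n \in F -> a n <= A) ->
  (forall n, n \in F -> a n = 0 \/ A <= a n * 2 ^+ J) ->
  (forall t, 0 < t -> t * (count (fun n => t <= a n) F)%:R <= W) ->
  \sum_(n <- F) a n `^ s <= 2 / (1 - 2^-1 `^ (s - 1)) * W * A `^ (s - 1).
Proof.
move=> s1 W0 a0; set h := 2^-1 `^ (s - 1).
have h1 : h < 1 by apply: powR_lt1; rewrite ?subr_gt0 //; lra.
have h0 : 0 <= h by exact: powR_ge0.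
have C0 : 0 < 1 - h by lra.
have C2 : 2 <= 2 / (1 - h) by rewrite ler_pdivlMr //; lra.
have top (F : seq T) (A B : R) : 0 < A -> 0 < B ->
    (forall n, n \in F -> a n <= A) ->
    (forall t, 0 < t -> t * (count (fun n => t <= a n) F)%:R <= W) ->
    \sum_(n <- F | B <= a n) a n `^ s <= A `^ s * (W / B).
  move=> A0 B0 aA aW.
  apply: (@le_trans _ _ (\sum_(n <- F | B <= a n) A `^ s)).
    rewrite big_seq_cond [leRHS]big_seq_cond; apply: ler_sum => n /andP[nF _].
    by apply: powR_le; rewrite ?aA //; lra.
  rewrite big_const_seq iter_addr_0 -[leLHS]mulr_natr.
  rewrite ler_wpM2l ?powR_ge0 // ler_pdivlMr // mulrC; exact: aW.
elim=> [|J IH] F A A0 aA aJ aW.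
  rewrite (bigID (fun n => A <= a n)) /= [X in _ + X]big_seq_cond.
  rewrite [X in _ + X]big1 ?addr0; last first.
    move=> n /andP[nF]; case: (aJ _ nF) => [->|]; last by rewrite mulr1 => ->.
    by rewrite powR0 // gt_eqF //; lra.
  apply: (le_trans (top _ _ _ A0 A0 aA aW)).
  have -> : A `^ s * (W / A) = W * A `^ (s - 1).
    rewrite (@powR_split _ _ s (ltW A0) (ltW s1)); field; by rewrite gt_eqF.
  rewrite ler_wpM2r ?powR_ge0 // ler_peMl //; lra.
rewrite (bigID (fun n => A / 2 <= a n)) /=.
have A20 : 0 < A / 2 by lra.
have := top _ _ _ A0 A20 aA aW.
have -> : A `^ s * (W / (A / 2)) = 2 * W * A `^ (s - 1).
  rewrite (@powR_split _ _ s (ltW A0) (ltW s1)); field; rewrite gt_eqF //.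
move=> H1.
have H2 : \sum_(n <- F | ~~ (A / 2 <= a n)) a n `^ s <=
    2 / (1 - h) * W * (A / 2) `^ (s - 1).
  rewrite -big_filter; apply: IH => //.
  - by move=> n; rewrite mem_filter -ltNge => /andP[/ltW].
  - move=> n; rewrite mem_filter => /andP[_ /aJ[->|]]; first by left.
    by rewrite exprS => H; right; lra.
  - move=> t t0; apply: le_trans (aW t t0); rewrite ler_wpM2l ?(ltW t0) // ler_nat.
    rewrite count_filter; apply: sub_count => n /=; by case/andP.
apply: (le_trans (lerD H1 H2)).
rewrite powRM ?invr_ge0 ?(ltW A0) // -/h.
set P := A `^ (s - 1); rewrite [leRHS](_ : _ =
  2 * W * P + 2 / (1 - h) * W * (P * h)) //.
by field; rewrite gt_eqF.
Qed.

(** This passage from a weak-type to a strong-type bound serves twice: for the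
    kernels [|n|^(- sigma)] and for the maximal function of a finite set. *)
Lemma weak_to_strong (s : R) (a : T -> R) (W A : R) (F : seq T) :
  1 < s -> 0 <= W -> 0 < A ->
  (forall n, 0 <= a n) ->
  (forall n, n \in F -> a n <= A) ->
  (forall t, 0 < t -> t * (count (fun n => t <= a n) F)%:R <= W) ->
  \sum_(n <- F) a n `^ s <= 2 / (1 - 2^-1 `^ (s - 1)) * W * A `^ (s - 1).
Proof.
move=> s1 W0 A0 a0 aA aW.
have [J HJ] : exists J, forall n, n \in F -> a n = 0 \/ A <= a n * 2 ^+ J.
  elim: (F) => [|x F' [J IH]]; first by exists 0%N.
  have [ax0|ax0] := eqVneq (a x) 0.
    by exists J => n; rewrite inE => /predU1P[->|/IH//]; left.
  have axp : 0 < a x by rewrite lt_neqAle eq_sym ax0 a0.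
  set K := Num.bound (A / a x).
  have HK : A <= a x * 2 ^+ K.
    by rewrite mulrC -ler_pdivrMr // ltW // upper_nthrootP.
  have mono (y : R) (i j : nat) : 0 <= y -> (i <= j)%N ->
      A <= y * 2 ^+ i -> A <= y * 2 ^+ j.
    move=> y0 ij /le_trans; apply; rewrite ler_wpM2l // ler_weXn2l //; lra.
  exists (maxn J K) => n; rewrite inE => /predU1P[->|/IH[->|H]].
  - by right; apply: mono HK; rewrite // leq_maxr.
  - by left.
  - by right; apply: mono H; rewrite // leq_maxl.
exact: sum_powR_halving HJ aW.
Qed.
End WeakStrong.

(** * Boxes in the lattice and power kernels *)

Section Lattice.
Variable d : nat.
Implicit Types (m n v : 'rV[int]_d) (k : nat).

Definition latnorm v : nat := (\max_i `|v 0%R i|)%N.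

Lemma latnorm_leP v k : reflect (forall i, `|v 0%R i| <= k)%N (latnorm v <= k)%N.
Proof.
rewrite /latnorm; apply: (iffP (bigmax_leqP _ _ _)) => [H i|H i _]; exact: H.
Qed.

Lemma latnorm_ge v i : (`|v 0%R i| <= latnorm v)%N.
Proof. by rewrite /latnorm (bigD1 i) // leq_maxl. Qed.

Lemma latnormN v : latnorm (- v) = latnorm v.
Proof. by apply: eq_bigr => i _; rewrite !mxE abszN. Qed.

Lemma latnormD v m : (latnorm (v + m) <= latnorm v + latnorm m)%N.
Proof.
apply/latnorm_leP => i; rewrite !mxE.
move: (latnorm_ge v i) (latnorm_ge m i).
by move: (v 0%R i) (m 0%R i) => x y; lia.
Qed.

Lemma latnormBC m n : latnorm (m - n) = latnorm (n - m).
Proof. by rewrite -latnormN opprB. Qed.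

Definition box n k : {fset 'rV[int]_d} :=
  [fset (n + \row_i ((u i : nat)%:Z - k%:Z))%R
     | u : {ffun 'I_d -> 'I_(k.*2.+1)} in predT]%fset.

Lemma in_box m n k : (m \in box n k) = (latnorm (m - n) <= k)%N.
Proof.
apply/imfsetP/latnorm_leP => /= [[u _ ->] i|H].
  by rewrite addrAC subrr add0r mxE; have := ltn_ord (u i); lia.
exists [ffun i => inord (absz ((m - n) 0 i + k%:Z)%R)] => //.
apply/rowP => i; have := H i; rewrite !mxE !ffunE !mxE.
move: (m 0%R i) (n 0%R i) => x y Hi.
by rewrite inordK; lia.
Qed.

Lemma card_box n k : (#|` box n k| <= k.*2.+1 ^ d)%N.
Proof.
by rewrite (leq_trans (leq_imfset_card _ _ _)) // -cardE card_ffun !card_ord.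
Qed.

End Lattice.

Section Kernel.
Variables (R : realType) (d : nat).
Hypothesis d0 : (0 < d)%N.
Implicit Types (m n v : 'rV[int]_d) (k : nat) (g : 'rV[int]_d -> R).

(** [max (1, |v|)], so that negative powers make sense at the origin *)
Definition latweight v : R := (maxn 1 (latnorm v))%:R.

Lemma latweight_ge1 v : 1 <= latweight v.
Proof. by rewrite ler1n leq_maxl. Qed.

Lemma latweight_gt0 v : 0 < latweight v.
Proof. by rewrite (lt_le_trans ltr01) ?latweight_ge1. Qed.

(** The function [|n - m|^(- d)] is in weak l^1, since a box of radius [k] has
    about [k^d] points; hence its power of exponent [sigma / d > 1] is summable,
    uniformly in the centre [m]. *)
Lemma kernel_sum_bounded (sigma : R) : d%:R < sigma ->
  exists2 C : R, 0 < C & forall m (F : {fset 'rV[int]_d}),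
    \sum_(n <- F) latweight (n - m) `^ (- sigma) <= C.
Proof.
move=> ds; have d0R : 0 < d%:R :> R by rewrite ltr0n.
set s := sigma / d%:R; have s1 : 1 < s by rewrite ltr_pdivlMr // mul1r.
have h1 : 2^-1 `^ (s - 1) < 1 :> R by apply: powR_lt1; rewrite ?subr_gt0 //; lra.
exists (2 / (1 - 2^-1 `^ (s - 1)) * (3 ^ d)%:R) => [|m F].
  by rewrite mulr_gt0 // ?divr_gt0 ?subr_gt0 // ltr0n expn_gt0.
pose a n : R := latweight (n - m) `^ (- d%:R).
have aE n : latweight (n - m) `^ (- sigma) = a n `^ s.
  rewrite /a -powRrM; congr (_ `^ _); rewrite /s; field; by rewrite gt_eqF.
under eq_bigr do rewrite aE.
have a1 n : a n <= 1.
  rewrite /a powRN invf_le1 ?powR_gt0 ?latweight_gt0 //.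
  by rewrite powR_ge1 ?latweight_ge1.
have := @weak_to_strong R _ s a (3 ^ d)%:R 1 F s1 (ler0n _ _) ltr01.
rewrite powR1 mulr1; apply => // [n|t t0]; first exact: powR_ge0.
have [t1|t1] := ltP 1 t.
  rewrite (_ : count _ _ = 0%N) ?mulr0 //.
  apply/eqP; rewrite -leqn0 leqNgt -has_count; apply/hasPn => n _ /=.
  by rewrite -ltNge; apply: le_lt_trans t1.
set k := Num.truncn (t `^ (- d%:R^-1)).
have tk : k%:R <= t `^ (- d%:R^-1) by rewrite truncn_le powR_ge0.
have k1 : (1 <= k)%N.
  rewrite truncn_gt0 powRN invf_ge1 ?powR_gt0 //.
  by rewrite powR_le1 ?invr_ge0 // ltW.
have cnt : (count (fun n => (t <= a n)%R) F <= 3 ^ d * k ^ d)%N.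
  rewrite -size_filter -expnMn.
  apply: (@leq_trans (k.*2.+1 ^ d)%N); last by rewrite leq_exp2r //; lia.
  apply: leq_trans (card_box m k).
  apply: uniq_leq_size; first by rewrite filter_uniq // fset_uniq.
  move=> n; rewrite mem_filter in_box => /andP[ta _].
  apply: (@leq_trans (maxn 1 (latnorm (n - m)))); first exact: leq_maxr.
  rewrite truncn_ge_nat ?powR_ge0 // -/(latweight (n - m)).
  have : (a n) `^ (- d%:R^-1) <= t `^ (- d%:R^-1).
    by apply: powRN_le => //; rewrite invr_ge0.
  by rewrite /a -powRrM mulrNN divff ?gt_eqF // powRr1 // ltW // latweight_gt0.
have tkd : t * k%:R ^+ d <= 1.
  have : k%:R `^ d%:R <= (t `^ (- d%:R^-1)) `^ d%:R by apply: powR_le.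
  rewrite -powRrM mulNr mulVf ?gt_eqF // powR_inv1 ?(ltW t0) //.
  by rewrite (powR_mulrn d (ler0n R k)) => H; rewrite mulrC -ler_pdivlMr // div1r.
apply: (@le_trans _ _ (t * (3 ^ d * k ^ d)%:R)).
  by rewrite ler_wpM2l ?(ltW t0) // ler_nat.
rewrite natrM mulrCA [X in _ * (_ * X)]natrX.
by rewrite ler_piMr.
Qed.

Definition boxsum g n k : R := \sum_(m <- box n k) g m.

(** For nonnegative [g] this is the bound of the l^1 norm of [g] by [A]; in terms
    of finite sums it stays within the real numbers. *)
Definition fsums_le g (A : R) :=
  forall F : {fset 'rV[int]_d}, \sum_(n <- F) g n <= A.

Lemma fsums_le_ge0 g A : fsums_le g A -> 0 <= A.
Proof. by move=> /(_ fset0); rewrite big_seq_fset0. Qed.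

Lemma boxsum_ge0 g n k : (forall n, 0 <= g n) -> 0 <= boxsum g n k.
Proof. by move=> g0; apply: sumr_ge0. Qed.

(** A substitute for Young's convolution inequality in the case of l^1 data: a
    box sum [S] is at most [A], so [S^q <= A^(q-1) S], which is linear in [g], and
    exchanging the two sums leaves the kernel sums bounded by [C].  The radii
    [k n] are arbitrary, as they come from linearizing a supremum. *)
Lemma boxsum_power_bound (s q C A : R) g (F : {fset 'rV[int]_d})
    (k : 'rV[int]_d -> nat) :
  1 <= q -> 0 <= s -> 0 <= C -> (forall n, 0 <= g n) -> fsums_le g A ->
  (forall n, n \in F -> 0 < k n)%N ->
  (forall m, 0 < g m ->
     \sum_(n <- F | m \in box n (k n)) latweight (n - m) `^ (- (s * q)) <= C) ->
  \sum_(n <- F) ((k n)%:R `^ (- s) * boxsum g n (k n)) `^ q <= C * A `^ q.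
Proof.
move=> q1 s0 C0 g0 gA k0 HC; have A0 := fsums_le_ge0 gA.
have q0 : 0 <= q by lra.
set Z : {fset 'rV[int]_d} := (\bigcup_(n <- F) box n (k n))%fset.
apply: (@le_trans _ _ (\sum_(n <- F) A `^ (q - 1) *
    \sum_(m <- Z | m \in box n (k n)) latweight (n - m) `^ (- (s * q)) * g m)).
  apply: ler_fsum => n nF.
  rewrite powRM ?powR_ge0 ?boxsum_ge0 // -powRrM mulNr.
  rewrite (@powR_split _ (boxsum _ _ _)) ?boxsum_ge0 // mulrCA.
  apply: ler_pM; rewrite ?powR_ge0 ?mulr_ge0 ?boxsum_ge0 //.
    apply: powR_le; rewrite ?boxsum_ge0 ?subr_ge0 //; exact: gA.
  have -> : boxsum g n (k n) = \sum_(m <- Z | m \in box n (k n)) g m.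
    apply: fsum_mem_cond => m mn.
    by apply/bigfcupP; exists n; rewrite ?nF.
  rewrite mulr_sumr; apply: ler_sum => m; rewrite in_box => mn.
  rewrite ler_wpM2r // powRN_le ?latweight_gt0 ?mulr_ge0 // ler_nat.
  by rewrite geq_max k0 // latnormBC.
rewrite -mulr_sumr (exchange_big_dep predT) //=.
rewrite (powR_split A0 q1) mulrCA ler_wpM2l ?powR_ge0 //.
apply: (@le_trans _ _ (\sum_(m <- Z) C * g m)); last first.
  by rewrite -mulr_sumr ler_wpM2l.
apply: ler_sum => m _; rewrite -mulr_suml.
have := g0 m; rewrite le_eqVlt => /predU1P[<-|gm]; first by rewrite !mulr0.
by rewrite ler_wpM2r // HC.
Qed.
End Kernel.

(** * The maximal function of a finite set *)

Lemma exists_fset_argmax (T : choiceType) (F : {fset T}) (k : T -> nat) n0 :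
  n0 \in F -> exists2 n, n \in F & forall m, m \in F -> (k m <= k n)%N.
Proof.
move=> n0F.
case: (@arg_maxnP F [` n0F]%fset xpredT (fun i => k (val i))) => // n _ Hn.
exists (val n) => [|m mF]; first exact: valP.
exact: (Hn [` mF]%fset).
Qed.

Lemma card_fset_filter (T : choiceType) (F : {fset T}) (p : pred T) :
  #|` [fset n in F | p n]%fset| = count p F.
Proof. by rewrite -sum1_size big_fset /= sum1_count. Qed.

Section RestrictedMaximal.
Variables (R : realType) (d : nat).
Hypothesis d0 : (0 < d)%N.
Implicit Types (E F : {fset 'rV[int]_d}) (k : 'rV[int]_d -> nat).

(** Vitali's selection: the largest box of the family is kept, the centres at
    distance at most twice its radius are counted by its dilate, and the boxes of
    the remaining centres are disjoint from it, so that induction applies to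
    these centres and to [E] without the kept box. *)
Lemma restricted_weak_type E F k (t : R) : 0 < t ->
  (forall n, n \in F -> 0 < k n)%N ->
  (forall n, n \in F ->
     t * (k n ^ d)%:R <= #|` (E `&` box n (k n))%fset|%:R) ->
  t * #|` F|%:R <= (5 ^ d)%:R * #|` E|%:R.
Proof.
move=> t0; have [N] := ubnP #|` F|; elim: N => // N IH in E F *.
rewrite ltnS => FN k0 HE.
have [->|[n0 n0F]] := fset_0Vmem F; first by rewrite cardfs0 mulr0 -natrM ler0n.
have [n nF nmax] := exists_fset_argmax k n0F.
pose F' := [fset m in F | m \notin box n (2 * k n)]%fset.
pose E' := (E `\` box n (k n))%fset.
have F'F m : m \in F' -> m \in F /\ (2 * k n < latnorm (m - n))%N.
  by rewrite !inE /= in_box -ltnNge => /andP[].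
have F'N : (#|` F'| < N)%N.
  apply: leq_trans FN; rewrite [leqRHS](cardfsD1 n) nF ltnS.
  apply/fsubset_leq_card/fsubsetP => m mF'; have [mF mn] := F'F m mF'.
  rewrite !inE mF andbT; apply: contraTneq mn => ->; rewrite subrr -leqNgt.
  by apply/latnorm_leP => i; rewrite mxE.
have IH' : t * #|` F'|%:R <= (5 ^ d)%:R * #|` E'|%:R.
  apply: IH => // [m /F'F[/k0]//|m /F'F[mF mn]].
  apply: (le_trans (HE m mF)); rewrite ler_nat; apply: fsubset_leq_card.
  apply/fsubsetP => x; rewrite !inE !in_box => /andP[-> xm]; rewrite xm !andbT /=.
  rewrite -ltnNge ltnNge; apply/negP => xn.
  have := latnormD (m - x) (x - n); rewrite subrKA (latnormBC m x).
  rewrite leqNgt => /negP; apply; apply: leq_ltn_trans mn.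
  by rewrite mul2n -addnn leq_add // (leq_trans xm) // nmax.
have FF' : (#|` F| <= #|` F'| + 5 ^ d * k n ^ d)%N.
  have -> : #|` F| = (#|` F'| + count (fun m => m \in box n (2 * k n)) F)%N.
    by rewrite card_fset_filter addnC count_predC.
  rewrite leq_add2l -expnMn.
  apply: (@leq_trans ((2 * k n).*2.+1 ^ d)%N); last first.
    by rewrite leq_exp2r //; have := k0 n nF; lia.
  apply: leq_trans (card_box n (2 * k n)).
  rewrite -card_fset_filter; apply: fsubset_leq_card.
  by apply/fsubsetP => m; rewrite !inE => /andP[].
have HEn := HE n nF.
have -> : #|` E| = (#|` (E `&` box n (k n))%fset| + #|` E'|)%N.
  by rewrite cardfsID.
apply: (@le_trans _ _ (t * (#|` F'| + 5 ^ d * k n ^ d)%:R)).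
  by rewrite ler_wpM2l ?(ltW t0) // ler_nat.
rewrite !natrD natrM !mulrDr addrC lerD // mulrCA ler_wpM2l ?ler0n //.
Qed.

(** The Hardy-Littlewood maximal theorem, for indicators of finite sets. *)
Lemma restricted_strong_type (s : R) : 1 < s -> exists2 C : R, 0 < C &
  forall E F k, (forall n, n \in F -> 0 < k n)%N ->
  \sum_(n <- F)
    (#|` (E `&` box n (k n))%fset|%:R / (k n ^ d)%:R) `^ s <= C * #|` E|%:R.
Proof.
move=> s1.
have h1 : 2^-1 `^ (s - 1) < 1 :> R by apply: powR_lt1; rewrite ?subr_gt0 //; lra.
exists (2 / (1 - 2^-1 `^ (s - 1)) * (5 ^ d)%:R * (3 ^ d)%:R `^ (s - 1)).
  rewrite !mulr_gt0 ?invr_gt0 ?subr_gt0 ?powR_gt0 ?ltr0n ?expn_gt0 //.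
move=> E F k k0.
have kd n : n \in F -> 0 < (k n ^ d)%:R :> R.
  by move=> nF; rewrite ltr0n expn_gt0 k0.
have := @weak_to_strong R _ s
  (fun n => #|` (E `&` box n (k n))%fset|%:R / (k n ^ d)%:R)
  ((5 ^ d)%:R * #|` E|%:R) (3 ^ d)%:R F s1.
rewrite -natrM ler0n ltr0n expn_gt0 => /(_ isT isT).
rewrite natrM mulrA -!mulrA [X in _ <= 2 * (_ * (_ * X))]mulrC !mulrA; apply.
- by move=> n; rewrite mulr_ge0 ?invr_ge0 ?ler0n.
- move=> n nF; rewrite ler_pdivrMr ?kd // -natrM ler_nat -expnMn.
  apply: (@leq_trans ((k n).*2.+1 ^ d)%N); last first.
    by rewrite leq_exp2r //; have := k0 n nF; lia.
  apply: leq_trans (card_box n (k n)); apply: fsubset_leq_card.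
  by apply/fsubsetP => m; rewrite !inE => /andP[].
- move=> t t0; rewrite -card_fset_filter.
  apply: (@restricted_weak_type _ _ k t t0) => n; rewrite !inE => /andP[nF].
    by rewrite k0.
  by rewrite ler_pdivlMr ?kd.
Qed.

(** Hedberg's trick: bounding [|E cap box|^(gamma / d)] by [|E|^(gamma / d)]
    leaves a power of the averages of the indicator of [E], to which the maximal
    theorem applies. *)
Lemma restricted_fractional (gamma q : R) :
  0 <= gamma -> 0 < q -> 1 < q * (1 - gamma / d%:R) ->
  exists2 C : R, 0 < C & forall E F k, (forall n, n \in F -> 0 < k n)%N ->
  \sum_(n <- F)
    ((k n)%:R `^ (- (d%:R - gamma)) * #|` (E `&` box n (k n))%fset|%:R) `^ q
  <= C * (#|` E|%:R `^ (gamma / d%:R + q^-1)) `^ q.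
Proof.
move=> g0 q0 s1; have d0R : 0 < d%:R :> R by rewrite ltr0n.
have [C C0 HC] := restricted_strong_type s1.
exists C => // E F k k0.
have [E0|[x xE]] := fset_0Vmem E.
  rewrite big1 ?mulr_ge0 ?powR_ge0 ?(ltW C0) // => n _.
  by rewrite E0 fset0I cardfs0 mulr0 powR0 // gt_eqF.
have E1 : 0 < #|` E|%:R :> R.
  by rewrite ltr0n cardfs_gt0; apply/fset0Pn; exists x.
have -> : C * (#|` E|%:R `^ (gamma / d%:R + q^-1)) `^ q =
    #|` E|%:R `^ (gamma / d%:R * q) * (C * #|` E|%:R).
  rewrite -powRrM mulrDl mulVf ?gt_eqF // powRDp // powRr1 ?(ltW E1) //.
  by rewrite mulrCA.
apply: le_trans (ler_wpM2l (powR_ge0 _ _) (HC E F k k0)).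
rewrite mulr_sumr; apply: ler_fsum => n nF.
set c := #|` _|.
have [->|c0] := eqVneq c 0%N.
  by rewrite mulr0 mul0r !powR0 ?mulr0 // gt_eqF // (lt_trans ltr01).
have cR : 0 < c%:R :> R by rewrite ltr0n lt0n.
have kR : 0 < (k n)%:R :> R by rewrite ltr0n k0.
have -> : ((k n)%:R `^ (- (d%:R - gamma)) * c%:R) `^ q =
  c%:R `^ (gamma / d%:R * q) * (c%:R / (k n ^ d)%:R) `^ (q * (1 - gamma / d%:R)).
  rewrite [q * _]mulrC [_ * q]mulrC [q * _]mulrC !powRrM -powRM ?powR_ge0 //.
  congr (_ `^ q); have -> : c%:R / (k n ^ d)%:R = c%:R * (k n)%:R `^ (- (d%:R)) :> R.
    by rewrite powRN powR_mulrn ?ler0n // natrX.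
  rewrite -powRrM powRM ?powR_ge0 ?ler0n // mulrA -powRDp //.
  have -> : gamma / d%:R + (1 - gamma / d%:R) = 1 by ring.
  rewrite powRr1 ?ler0n // mulrC -powRrM.
  congr (_ * _ `^ _); field; by rewrite gt_eqF.
rewrite ler_wpM2r ?powR_ge0 //; apply: powR_le.
- exact: ler0n.
- rewrite ler_nat fsubset_leq_card //.
  by apply/fsubsetP => m; rewrite !inE => /andP[].
- by rewrite !mulr_ge0 ?invr_ge0 // ltW.
Qed.
End RestrictedMaximal.

(** * The isoperimetric inequality *)

Section Isoperimetric.
Variables (R : realType) (d : nat).
Hypothesis d0 : (0 < d)%N.
Implicit Types (E F : {fset 'rV[int]_d}) (g : 'rV[int]_d -> R).

Lemma fsums_le_shift g (v : 'rV[int]_d) c :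
  fsums_le g c -> fsums_le (fun n => g (n + v)) c.
Proof.
move=> gc F.
have <- : \sum_(m <- [fset (n + v)%R | n in F]%fset) g m = \sum_(n <- F) g (n + v).
  by rewrite big_imfset //= => x y _ _ /addIr.
exact: gc.
Qed.

Definition translation_le g v c := fsums_le (fun n => `|g (n + v) - g n|) c.

Lemma translation_leD g v w c c' : translation_le g v c ->
  translation_le g w c' -> translation_le g (v + w) (c + c').
Proof.
move=> gv gw F; have := fsums_le_shift v gw F; have := gv F => {gv gw} H H'.
apply: le_trans (lerD H H'); rewrite -big_split /=; apply: ler_sum => n _.
by rewrite addrC addrA (le_trans _ (ler_normD _ _)) // subrKA.
Qed.

Lemma translation_le0 g : translation_le g 0 0.
Proof. by move=> F; rewrite big1 // => n _; rewrite addr0 subrr normr0. Qed.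

(** The bounds for the unit steps add up along a path from [0] to the vector [u]. *)
Lemma translation_le_box g (L : nat) (P : R) (u : 'I_d -> 'I_L) :
  (forall i, translation_le g (delta_mx 0 i) P) ->
  translation_le g (\sum_i (delta_mx 0 i *+ u i)) (d%:R * L%:R * P).
Proof.
move=> gP F.
have P0 : 0 <= P by have := gP (Ordinal d0) fset0; rewrite big_seq_fset0.
have : translation_le g (\sum_i (delta_mx 0 i *+ u i)) (\sum_(i < d) P *+ u i).
  apply: (big_ind2 (translation_le g)) => [|v c w c'|i _].
  - exact: translation_le0.
  - exact: translation_leD.
  elim: (u i : nat) => [|j IH]; first by rewrite !mulr0n; exact: translation_le0.
  by rewrite !mulrS; apply: translation_leD.
move=> /(_ F) /le_trans; apply.
apply: (@le_trans _ _ (\sum_(i < d) L%:R * P)).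
  apply: ler_sum => i _; rewrite -[leLHS]mulr_natl ler_wpM2r // ler_nat.
  by rewrite ltnW.
by rewrite sumr_const card_ord -[leLHS]mulr_natl mulrA.
Qed.

Definition fset_indicator E (n : 'rV[int]_d) : R := (n \in E)%:R.

(** Take a cube with at least [2 |E|] vectors and side [L] of order [|E|^(1/d)].
    Translating a point of [E] by these vectors, at least half of the translates
    leave [E]; on the other hand each of these translations changes the indicator
    of [E] by at most [d L P] in l^1. *)
Lemma isoperimetric E (P : R) : E != fset0 ->
  (forall i, translation_le (fset_indicator E) (delta_mx 0 i) P) ->
  #|` E|%:R `^ (1 - d%:R^-1) <= 8 * d%:R * P.
Proof.
move=> E0 HP; have d0R : 0 < d%:R :> R by rewrite ltr0n.
have E1 : (0 < #|` E|)%N by rewrite cardfs_gt0.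
set N := #|` E| in E1 *.
have N0 : 0 < N%:R :> R by rewrite ltr0n.
set x : R := (2 * N%:R) `^ d%:R^-1.
have x1 : 1 <= x.
  rewrite powR_ge1 ?invr_ge0 //; have : 1 <= N%:R :> R by rewrite ler1n.
  by lra.
(* the side of the cube: [2 |E| <= L^d], while [L] is at most [4 |E|^(1/d)] *)
pose L := (Num.truncn x).+1.
have Lx : L%:R <= 2 * x.
  rewrite /L -natr1; have : (Num.truncn x)%:R <= x; last by lra.
  by rewrite truncn_le powR_ge0.
have xL : x <= L%:R by rewrite ltW // truncnS_gt.
have NL : 2 * N%:R <= L%:R ^+ d :> R.
  have : x `^ d%:R <= L%:R `^ d%:R by apply: powR_le; rewrite ?powR_ge0.
  rewrite -powRrM mulVf ?gt_eqF // powRr1 ?mulr_ge0 ?ler0n //.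
  by rewrite (powR_mulrn d (ler0n R L)).
have Lx' : L%:R <= 4 * N%:R `^ d%:R^-1 :> R.
  apply: (le_trans Lx); rewrite /x powRM ?ler0n // mulrA ler_wpM2r ?powR_ge0 //.
  rewrite -[leRHS](_ : 2 * 2 = 4 :> R); last by ring.
  rewrite ler_pM2l // -[leRHS](powRr1 (_ : 0 <= 2)) //.
  by rewrite ler_powR ?ler1n // invf_le1 // ler1n.
pose tr (u : {ffun 'I_d -> 'I_L}) : 'rV[int]_d := \sum_i (delta_mx 0 i *+ u i).
have trE u i : tr u 0 i = (u i : nat)%:Z.
  rewrite /tr summxE (bigD1 i) //= big1 => [|j ji].
    rewrite addr0 mulmxnE mxE !eqxx; exact: natz.
  by rewrite mulmxnE mxE eq_sym (negPf ji) andbF mul0rn.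
have tr_inj n : injective (fun u => n + tr u).
  move=> u v /addrI uv; apply/ffunP => i; apply/val_inj.
  by have := trE u i; rewrite uv trE => -[].
have up : \sum_(u : {ffun 'I_d -> 'I_L}) \sum_(n <- E)
    `|fset_indicator E (n + tr u) - fset_indicator E n| <=
    L%:R ^+ d * (d%:R * L%:R * P).
  apply: (@le_trans _ _ (\sum_(u : {ffun 'I_d -> 'I_L}) d%:R * L%:R * P)).
    by apply: ler_sum => u _; apply: translation_le_box.
  by rewrite sumr_const card_ffun !card_ord -[leLHS]mulr_natl natrX.
have low : N%:R * (L%:R ^+ d - N%:R) <=
  \sum_(u : {ffun 'I_d -> 'I_L}) \sum_(n <- E)
    `|fset_indicator E (n + tr u) - fset_indicator E n|.
  rewrite exchange_big /= (_ : N%:R * _ = \sum_(n <- E) (L%:R ^+ d - N%:R)).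
    apply: ler_fsum => n nE.
    apply: (@le_trans _ _ (\sum_(u : {ffun 'I_d -> 'I_L})
        (1 - fset_indicator E (n + tr u)))); last first.
      apply: ler_sum => u _; rewrite /fset_indicator nE distrC.
      by rewrite ger0_norm // subr_ge0 lern1 leq_b1.
    rewrite sumrB sumr_const card_ffun !card_ord natrX lerB // -natr_sum ler_nat.
    rewrite (eq_bigr (fun u => if n + tr u \in E then 1%N else 0%N)); last first.
      by move=> u _; case: (_ \in E).
    rewrite -big_mkcond /=.
    have /= := card_imfset imfset_key
      (mem [pred u : {ffun 'I_d -> 'I_L} | n + tr u \in E]) (tr_inj n).
    rewrite -cardE -sum1_card => Hc.
    apply: leq_trans; first exact: (eq_leq (esym Hc)).
    apply/fsubset_leq_card/fsubsetP => m.
    by case/imfsetP => u /= uE ->.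
  by rewrite big_const_seq count_predT iter_addr_0 mulr_natl.
have key : N%:R <= 2 * (d%:R * L%:R * P).
  have := le_trans low up; set D := L%:R ^+ d in NL *; set Y := d%:R * _ * P.
  have D0 : 0 < D by lra.
  have H : 0 <= N%:R * (D - 2 * N%:R) by rewrite mulr_ge0 // subr_ge0.
  by move=> H'; rewrite -(ler_pM2l D0); nra.
have P0 : 0 <= P by have := HP (Ordinal d0) fset0; rewrite big_seq_fset0.
rewrite powRB ?(gt_eqF N0) ?implybT // powRr1 // ler_pdivrMr ?powR_gt0 //.
apply: (le_trans key).
have := ler_wpM2r (mulr_ge0 (ltW d0R) P0) Lx'.
by set z := N%:R `^ _; nra.
Qed.

End Isoperimetric.

(** * Interpolation and Minkowski inequalities *)

(** Writing an interpolated bound as a linear one, valid for every [lam], lets it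
    be added over the layers of a function. *)
Lemma powR_interp (R : realType) (x y lam alpha : R) : 0 <= x -> 0 <= y ->
  0 < lam -> 0 <= alpha <= 1 ->
  x `^ (1 - alpha) * y `^ alpha <= lam `^ alpha * x + lam `^ (alpha - 1) * y.
Proof.
move=> x0 y0 l0 /andP[a0 a1].
have a1' : 0 <= 1 - alpha by lra.
have [yx|xy] := leP y (lam * x).
  apply: (@le_trans _ _ (x `^ (1 - alpha) * (lam * x) `^ alpha)).
    by rewrite ler_wpM2l ?powR_ge0 // powR_le.
  rewrite powRM ?(ltW l0) // mulrCA.
  have [->|xn] := eqVneq x 0.
    have [->|an] := eqVneq alpha 0.
      by rewrite subr0 powRr1 // mul0r mulr0 addr_ge0 ?mulr_ge0 ?powR_ge0.
    by rewrite (powR0 an) !mulr0 addr_ge0 ?mulr_ge0 ?powR_ge0.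
  have xp : 0 < x by rewrite lt_neqAle eq_sym xn.
  by rewrite -powRDp // subrK powRr1 // lerDl mulr_ge0 ?powR_ge0.
have yp : 0 < y by apply: le_lt_trans xy; rewrite mulr_ge0 // ltW.
move: xy; rewrite -ltr_pdivlMl // => /ltW xy.
apply: (@le_trans _ _ ((lam^-1 * y) `^ (1 - alpha) * y `^ alpha)).
  by rewrite ler_wpM2r ?powR_ge0 // powR_le.
rewrite powRM ?invr_ge0 ?(ltW l0) // -mulrA -powRDp // subrK powRr1 //.
rewrite -powR_inv1 ?(ltW l0) // -powRrM mulN1r opprB.
by rewrite lerDr mulr_ge0 ?powR_ge0.
Qed.

(** Convexity of the power function at the points [x / P] and [y / Q], with
    weights proportional to [P] and [Q], in the form that sums up to Minkowski's
    inequality. *)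
Lemma powR_convex2 (R : realType) (x y P Q q : R) : 1 <= q ->
  0 <= x -> 0 <= y -> 0 < P -> 0 < Q ->
  (x + y) `^ q <= (P + Q) `^ (q - 1) *
    (P * (x / P) `^ q + Q * (y / Q) `^ q).
Proof.
move=> q1 x0 y0 P0 Q0; have S0 : 0 < P + Q by rewrite addr_gt0.
have t0 : 0 <= P / (P + Q) by rewrite divr_ge0 // ltW.
have t1 : P / (P + Q) <= 1 by rewrite ler_pdivrMr // mul1r lerDl ltW.
have H : (P / (P + Q) * (x / P) + (1 - P / (P + Q)) * (y / Q)) `^ q <=
    P / (P + Q) * (x / P) `^ q + (1 - P / (P + Q)) * (y / Q) `^ q.
  by apply: (convex_powR q1 (Itv01 t0 t1)); rewrite inE /= in_itv /= andbT
    divr_ge0 // ltW.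
move: H.
have -> : P / (P + Q) * (x / P) + (1 - P / (P + Q)) * (y / Q) = (x + y) / (P + Q).
  by field; rewrite !gt_eqF.
rewrite powRM ?addr_ge0 ?invr_ge0 ?(ltW S0) // powR_invl ?(ltW S0) //.
rewrite ler_pdivrMr ?powR_gt0 // => /le_trans; apply.
rewrite (@powR_split _ (P + Q) q (ltW S0) q1) le_eqVlt; apply/orP; left.
by apply/eqP; field; rewrite gt_eqF.
Qed.

Section Minkowski.
Variables (R : realType) (T : choiceType).
Implicit Types (F : {fset T}) (x y : T -> R).

Lemma fsum_ge_term F x n : (forall n, 0 <= x n) -> n \in F ->
  x n <= \sum_(m <- F) x m.
Proof.
move=> x0 nF; rewrite -(big_seq_fset1 (+%R) n x).
by apply: fsum_le_sub => // m; rewrite inE => /eqP ->.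
Qed.

Lemma fsum_powR_eq0 F x (q : R) : 0 < q -> (forall n, 0 <= x n) ->
  \sum_(n <- F) x n `^ q <= 0 -> forall n, n \in F -> x n = 0.
Proof.
move=> q0 x0 H n nF; apply/eqP.
have /eqP : x n `^ q = 0.
  apply/le_anti; rewrite powR_ge0 andbT; apply: le_trans H.
  by apply: (@fsum_ge_term _ (fun n => x n `^ q)) => // m; exact: powR_ge0.
by rewrite powR_eq0 => /andP[].
Qed.

Lemma fsum_minkowski F x y (P Q q : R) : 1 <= q ->
  (forall n, 0 <= x n) -> (forall n, 0 <= y n) -> 0 <= P -> 0 <= Q ->
  \sum_(n <- F) x n `^ q <= P `^ q -> \sum_(n <- F) y n `^ q <= Q `^ q ->
  \sum_(n <- F) (x n + y n) `^ q <= (P + Q) `^ q.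
Proof.
move=> q1 x0 y0; have q0 : 0 < q by lra.
rewrite le_eqVlt => /predU1P[<- Q0|P0].
  rewrite powR0 ?gt_eqF // add0r => /(fsum_powR_eq0 q0 x0) H HQ; apply: le_trans HQ.
  by apply: ler_fsum => n /H ->//; rewrite add0r.
rewrite le_eqVlt => /predU1P[<- + |Q0 HP HQ].
  rewrite [0 `^ q]powR0 ?gt_eqF // addr0 => HP /(fsum_powR_eq0 q0 y0) H.
  by apply: le_trans HP; apply: ler_fsum => n /H ->//; rewrite addr0.
apply: (@le_trans _ _ (\sum_(n <- F) (P + Q) `^ (q - 1) *
    (P * (x n / P) `^ q + Q * (y n / Q) `^ q))).
  by apply: ler_sum => n _; apply: powR_convex2.
have scal z (M : R) : 0 < M -> (forall n, 0 <= z n) ->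
    \sum_(n <- F) z n `^ q <= M `^ q -> \sum_(n <- F) M * (z n / M) `^ q <= M.
  move=> M0 z0 H; rewrite -mulr_sumr -[leRHS]mulr1 ler_pM2l //.
  under eq_bigr do rewrite powRM ?invr_ge0 ?(ltW M0) // powR_invl ?(ltW M0) //.
  by rewrite -mulr_suml ler_pdivrMr ?powR_gt0 // mul1r.
have S0 : 0 < P + Q by rewrite addr_gt0.
rewrite -mulr_sumr big_split /= [leRHS](powR_split (ltW S0) q1).
by rewrite ler_wpM2l ?powR_ge0 // lerD // scal.
Qed.
End Minkowski.

(** * Layers of a function *)

Section LayerCake.
Variables (R : realType) (d : nat).
Hypothesis d0 : (0 < d)%N.
Implicit Types (E F Z : {fset 'rV[int]_d}) (k : 'rV[int]_d -> nat).
Implicit Types (f g w : 'rV[int]_d -> R).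

Lemma boxsumZ v g n r : boxsum (fun m => v * g m) n r = v * boxsum g n r.
Proof. by rewrite /boxsum mulr_sumr. Qed.

Lemma boxsumD f g n r : boxsum (fun m => f m + g m) n r =
  boxsum f n r + boxsum g n r.
Proof. exact: big_split. Qed.

Lemma boxsum_le f g n r : (forall m, m \in box n r -> f m <= g m) ->
  boxsum f n r <= boxsum g n r.
Proof. exact: ler_fsum. Qed.

Lemma boxsum_indicator E n r :
  boxsum (fset_indicator R E) n r = #|` (E `&` box n r)%fset|%:R.
Proof.
rewrite -fsum1E (@fsum_mem_cond _ _ _ (box n r)); last first.
  by move=> x; rewrite inE => /andP[].
rewrite /boxsum big_mkcond [RHS]big_mkcond big_seq [RHS]big_seq.
apply: eq_bigr => m mn; rewrite /fset_indicator !inE mn andbT.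
by case: (m \in E).
Qed.

(** The total variation of [g], restricted to a finite window [Z] so that it is a
    finite sum and splits exactly over the layers of [g]. *)
Definition grad_fsum Z g : R :=
  \sum_(i < d) \sum_(n <- Z) `|g (n + delta_mx 0 i) - g n|.

(** Peeling off the lowest layer of a finitely supported function splits both
    its sum and its total variation exactly, so that a linear bound on
    indicators passes to all functions. *)
Lemma layer_cake (F Z E0 : {fset 'rV[int]_d}) k w (q a b : R) :
  1 <= q -> (forall n, 0 <= w n) -> 0 < a -> 0 < b ->
  {subset E0 <= Z} ->
  (forall E, E != fset0 -> {subset E <= E0} ->
    \sum_(n <- F) (w n * boxsum (fset_indicator R E) n (k n)) `^ q <=
    (a * grad_fsum Z (fset_indicator R E) +
     b * \sum_(n <- Z) fset_indicator R E n) `^ q) ->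
  forall g, (forall n, 0 <= g n) -> (forall n, g n != 0 -> n \in E0) ->
    \sum_(n <- F) (w n * boxsum g n (k n)) `^ q <=
    (a * grad_fsum Z g + b * \sum_(n <- Z) g n) `^ q.
Proof.
move=> q1 w0 a0 b0 E0Z HE g.
have q0 : 0 < q by lra.
have Phi0 h : (forall n, 0 <= h n) ->
    0 <= a * grad_fsum Z h + b * \sum_(n <- Z) h n.
  move=> h0; rewrite addr_ge0 // mulr_ge0 ?(ltW a0) ?(ltW b0) ?sumr_ge0 //.
  by move=> i _; apply: sumr_ge0.
have [N] := ubnP #|` [fset n in E0 | g n != 0]%fset|.
elim: N => // N IH in g *; rewrite ltnS => gN g0 gE0.
set E := [fset n in E0 | g n != 0]%fset in gN *.
have memE n : (n \in E) = (g n != 0).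
  by rewrite !inE /= andb_idl // => /gE0.
have [EE|[n0 n0E]] := fset_0Vmem E.
  rewrite big1 => [|n _]; first exact: powR_ge0.
  rewrite (_ : boxsum _ _ _ = 0) ?mulr0 ?powR0 ?gt_eqF // /boxsum big1 //.
  by move=> m _; apply/eqP; move: (memE m); rewrite EE inE => /esym/negbFE.
have [n1 n1E n1min] : exists2 n1, n1 \in E & forall m, m \in E -> g n1 <= g m.
  case: (@arg_minP _ _ _ [` n0E]%fset xpredT (fun i => g (val i))) => // n _ Hn.
  exists (val n) => [|m mE]; first exact: valP.
  exact: (Hn [` mE]%fset).
set v := g n1.
have v0 : 0 < v by rewrite lt_neqAle g0 andbT eq_sym -memE.
pose g' n := g n - v * fset_indicator R E n.
have gE n : g n = v * fset_indicator R E n + g' n by rewrite /g' addrC subrK.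
have g'0 n : 0 <= g' n.
  rewrite /g' /fset_indicator; case: (boolP (n \in E)) => nE.
    by rewrite mulr1 subr_ge0 n1min.
  by rewrite mulr0 subr0.
have g'E n : g' n != 0 -> n \in E /\ n != n1.
  move=> H; split.
    apply: contraNT H => nE; move: (nE); rewrite memE negbK => /eqP gn.
    by rewrite /g' /fset_indicator (negPf nE) mulr0 subr0 gn.
  by apply: contraNneq H => ->; rewrite /g' /fset_indicator n1E mulr1 subrr.
have E1 : E != fset0 by apply/fset0Pn; exists n0.
have EE0 : {subset E <= E0} by move=> n; rewrite memE => /gE0.
have IH' : \sum_(n <- F) (w n * boxsum g' n (k n)) `^ q <=
    (a * grad_fsum Z g' + b * \sum_(n <- Z) g' n) `^ q.
  apply: IH => // [|n /g'E[/EE0]//]; apply: leq_trans gN.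
  rewrite [leqRHS](cardfsD1 n1) n1E ltnS; apply/fsubset_leq_card/fsubsetP => n.
  rewrite !inE /= => /andP[_ /g'E[]]; rewrite memE => gn ->.
  by rewrite gE0.
have HEv : \sum_(n <- F) (w n * (v * boxsum (fset_indicator R E) n (k n))) `^ q
    <= (v * (a * grad_fsum Z (fset_indicator R E) +
     b * \sum_(n <- Z) fset_indicator R E n)) `^ q.
  have I0 n : 0 <= fset_indicator R E n by rewrite ler0n.
  rewrite powRM ?Phi0 ?(ltW v0) //.
  under eq_bigr do rewrite mulrCA powRM ?mulr_ge0 ?(boxsum_ge0 _ _ I0) ?(ltW v0) //.
  by rewrite -mulr_sumr ler_wpM2l ?powR_ge0 ?HE.
have -> : a * grad_fsum Z g + b * \sum_(n <- Z) g n =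
   v * (a * grad_fsum Z (fset_indicator R E) +
     b * \sum_(n <- Z) fset_indicator R E n) +
   (a * grad_fsum Z g' + b * \sum_(n <- Z) g' n).
  have -> : \sum_(n <- Z) g n =
      v * (\sum_(n <- Z) fset_indicator R E n) + \sum_(n <- Z) g' n.
    by rewrite mulr_sumr -big_split /=; apply: eq_bigr => n _; exact: gE.
  have -> : grad_fsum Z g = v * grad_fsum Z (fset_indicator R E) + grad_fsum Z g'.
    rewrite /grad_fsum mulr_sumr -big_split /=; apply: eq_bigr => i _.
    rewrite mulr_sumr -big_split /=; apply: eq_bigr => n _.
    set n' := n + _; rewrite (gE n) (gE n').
    have g'z m : m \notin E -> g' m = 0 by apply: contraNeq => /g'E[].
    rewrite /fset_indicator.
    case: (boolP (n \in E)) (boolP (n' \in E)) => [nE|/g'z ->] [nE'|/g'z ->].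
    - by rewrite subrr normr0 mulr0 add0r; congr (`|_|); ring.
    - rewrite !mulr0 mulr1 !sub0r add0r sub0r !normrN normr1 mulr1.
      by rewrite (ger0_norm (g'0 _)) ger0_norm // addr_ge0 // ltW.
    - rewrite !mulr0 mulr1 !subr0 normr1 mulr1 addr0 subr0.
      by rewrite (ger0_norm (g'0 _)) ger0_norm // addr_ge0 // ltW.
    - by rewrite !subrr !normr0 mulr0 addr0.
  ring.
have I0 n : 0 <= fset_indicator R E n by rewrite ler0n.
rewrite (eq_bigr (fun n => (w n * (v * boxsum (fset_indicator R E) n (k n)) +
   w n * boxsum g' n (k n)) `^ q)); last first.
  move=> n _; congr (_ `^ _); rewrite -mulrDr; congr (_ * _).
  by rewrite -boxsumZ -boxsumD; apply: eq_bigr => m _; exact: gE.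
apply: fsum_minkowski HEv IH'; rewrite ?mulr_ge0 ?Phi0 ?(ltW v0) // => n.
  by rewrite !mulr_ge0 ?boxsum_ge0 ?(ltW v0).
by rewrite !mulr_ge0 ?boxsum_ge0.
Qed.
End LayerCake.

(** * The critical estimate *)

Section CriticalBound.
Variables (R : realType) (d : nat).
Hypothesis d0 : (0 < d)%N.
Implicit Types (E F Z : {fset 'rV[int]_d}) (k : 'rV[int]_d -> nat).
Implicit Types (f g w : 'rV[int]_d -> R).

Lemma fsum_le_support F Z g : (forall n, 0 <= g n) ->
  (forall n, n \notin Z -> g n = 0) -> \sum_(n <- F) g n <= \sum_(n <- Z) g n.
Proof.
move=> g0 gZ; rewrite (@big_fset_incl _ _ _ _ Z (F `|` Z)%fset) ?fsubsetUr //.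
  by apply: fsum_le_sub => // n nF; rewrite inE nF.
by move=> n _; exact: gZ.
Qed.

(** This makes the truncations of a function in l^1 finitely supported. *)
Lemma finite_superlevel f b eps : (forall n, 0 <= f n) -> fsums_le f b ->
  0 < eps -> exists E, forall n, eps < f n -> n \in E.
Proof.
move=> f0 fb e0; have fin : finite_set [set n | eps < f n].
  apply: contrapT => /(@infinite_set_fset _ _ (Num.truncn (b / eps)).+1).
  move=> [B BA HB]; have : b / eps < #|` B|%:R.
    by apply: lt_le_trans (truncnS_gt _) _; rewrite ler_nat.
  rewrite ltr_pdivrMr // ltNge => /negP; apply; apply: le_trans (fb B).
  rewrite -fsum1E mulr_suml; apply: ler_fsum => n nB.
  by rewrite mul1r ltW //; exact: BA.
exists (fset_set [set n | eps < f n]) => n fn.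
by rewrite in_fset_set // inE.
Qed.

(** For an indicator, the restricted maximal bound gives
    [|E|^((d - 1 + alpha) / d) = (|E|^(1 - 1/d))^(1 - alpha) |E|^alpha], and the
    isoperimetric inequality bounds the first factor by the perimeter of [E].  In
    its linear form this bound then passes to all functions by layers. *)
Lemma critical_bound_finsupp (gamma alpha q : R) :
  0 <= gamma -> gamma + 1 < d%:R -> 0 <= alpha < 1 ->
  q = d%:R / (d%:R - 1 - gamma + alpha) ->
  exists2 C : R, 0 < C & forall f a b E0, (forall n, 0 <= f n) ->
    (forall n, f n != 0 -> n \in E0) ->
    fsums_le f b -> (forall i, translation_le f (delta_mx 0 i) a) ->
  forall F k, (forall n, n \in F -> 0 < k n)%N -> forall lam, 0 < lam ->
  \sum_(n <- F) ((k n)%:R `^ (- (d%:R - gamma)) * boxsum f n (k n)) `^ q <=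
  (C * (lam `^ alpha * a + lam `^ (alpha - 1) * b)) `^ q.
Proof.
move=> g0 gd /andP[a0 a1] qE; have d0R : 0 < d%:R :> R by rewrite ltr0n.
have den : 0 < d%:R - 1 - gamma + alpha by lra.
have q1 : 1 <= q by rewrite qE ler_pdivlMr // mul1r; lra.
have q0 : 0 < q by lra.
have s1 : 1 < q * (1 - gamma / d%:R).
  have -> : q * (1 - gamma / d%:R) = (d%:R - gamma) / (d%:R - 1 - gamma + alpha).
    by rewrite qE; field; rewrite !gt_eqF.
  by rewrite ltr_pdivlMr // mul1r; lra.
have [C1 C10 HC1] := restricted_fractional d0 g0 q0 s1.
pose C2 := C1 `^ q^-1; have C20 : 0 < C2 by rewrite powR_gt0.
have d1 : 1 <= d%:R :> R by rewrite ler1n.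
exists (C2 * (8 * d%:R * d%:R)) => [|f a b E0 f0 fE0 fb fa F k k0 lam lam0].
  by rewrite !mulr_gt0.
(* outside this window no indicator of a subset of [E0] has a nonzero difference *)
pose Z := (E0 `|` \bigcup_(i <- enum 'I_d)
  [fset (n - delta_mx 0 i)%R | n in E0])%fset.
have E0Z : {subset E0 <= Z} by move=> n nE; rewrite inE nE.
have ZN i n : n \notin Z -> (n \notin E0) && (n + delta_mx 0 i \notin E0).
  rewrite inE negb_or => /andP[-> /=]; apply: contra => nE.
  apply/bigfcupP; exists i; first by rewrite mem_enum.
  by apply/imfsetP; exists (n + delta_mx 0 i) => //=; rewrite addrK.
have b0 := fsums_le_ge0 fb.
have a0' : 0 <= a by have := fa (Ordinal d0) fset0; rewrite big_seq_fset0.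
have la0 : 0 < lam `^ alpha by rewrite powR_gt0.
have lb0 : 0 < lam `^ (alpha - 1) by rewrite powR_gt0.
pose A := C2 * (lam `^ alpha * (8 * d%:R)); pose B := C2 * lam `^ (alpha - 1).
have A0 : 0 < A by rewrite !mulr_gt0.
have B0 : 0 < B by rewrite !mulr_gt0.
have := @layer_cake R d F Z E0 k (fun n => (k n)%:R `^ (- (d%:R - gamma))) q A B
  q1 (fun n => powR_ge0 _ _) A0 B0 E0Z _ f f0 fE0.
move=> /(_ _)/le_trans; apply; last first.
  apply: powR_le; last by lra.
  + apply: addr_ge0; (apply: mulr_ge0; first exact: ltW); last exact: sumr_ge0.
    by apply: sumr_ge0 => i _; apply: sumr_ge0.
  + have gf : grad_fsum Z f <= d%:R * a.
      apply: (@le_trans _ _ (\sum_(i < d) a)).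
        by apply: ler_sum => i _; exact: fa.
      by rewrite sumr_const card_ord -[leLHS]mulr_natl.
    have sf : \sum_(n <- Z) f n <= b by exact: fb.
    have := ler_wpM2l (ltW A0) gf; have := ler_wpM2l (ltW B0) sf.
    set G := grad_fsum _ _; set S := \sum_(n <- Z) _ => H1 H2.
    have H3 : B * b <= C2 * (8 * d%:R * d%:R) * (lam `^ (alpha - 1) * b).
      rewrite /B -[leLHS]mulrA -[leRHS]mulrA; apply: ler_wpM2l; first exact: ltW.
      rewrite ler_peMl ?mulr_ge0 ?(ltW lb0) //; nra.
    apply: (le_trans (lerD H2 H1)); rewrite mulrDr lerD //.
    by rewrite /A le_eqVlt; apply/orP; left; apply/eqP; ring.
move=> E E1 EE0; apply: (le_trans (_ : _ <= C1 * (#|` E|%:R `^ (gamma / d%:R + q^-1)) `^ q)).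
  under eq_bigr do rewrite boxsum_indicator; exact: HC1.
have I0 n : 0 <= fset_indicator R E n by rewrite ler0n.
set P := grad_fsum Z _; set N : R := #|` E|%:R.
have P0 : 0 <= P by apply: sumr_ge0 => i _; apply: sumr_ge0.
have N0 : 0 < N by rewrite ltr0n cardfs_gt0.
have NS : N <= \sum_(n <- Z) fset_indicator R E n.
  apply: (@le_trans _ _ (\sum_(n <- E) fset_indicator R E n)).
    by rewrite /N -fsum1E; apply: ler_fsum => n nE; rewrite /fset_indicator nE.
  by apply: fsum_le_sub => // n /EE0/E0Z.
have iso : N `^ (1 - d%:R^-1) <= 8 * d%:R * P.
  apply: isoperimetric => // i F'; rewrite /P /grad_fsum.
  apply: (@le_trans _ _ (\sum_(n <- Z)
    `|fset_indicator R E (n + delta_mx 0 i) - fset_indicator R E n|)).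
    apply: fsum_le_support => // n /(ZN i)/andP[n1 n2].
    rewrite /fset_indicator (negPf (contra (EE0 _) n1)).
    by rewrite (negPf (contra (EE0 _) n2)) subrr normr0.
  by rewrite (bigD1 i) //= lerDl sumr_ge0 // => j _; apply: sumr_ge0.
have -> : C1 * (N `^ (gamma / d%:R + q^-1)) `^ q =
    (C2 * N `^ (gamma / d%:R + q^-1)) `^ q.
  rewrite [RHS]powRM ?powR_ge0 //; congr (_ * _).
  by rewrite /C2 -powRrM mulVf ?gt_eqF // powRr1 // ltW.
apply: powR_le; [by rewrite mulr_ge0 ?powR_ge0| |by lra].
have -> : gamma / d%:R + q^-1 = (1 - d%:R^-1) * (1 - alpha) + alpha.
  by rewrite qE; field; rewrite !gt_eqF.
rewrite powRDp // powRrM /A /B -!mulrA -mulrDr ler_wpM2l ?(ltW C20) //.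
have P8 : 0 <= 8 * d%:R * P by rewrite !mulr_ge0.
apply: (@le_trans _ _ ((8 * d%:R * P) `^ (1 - alpha) * N `^ alpha)).
  by rewrite ler_wpM2r ?powR_ge0 // powR_le ?powR_ge0 //; lra.
apply: (le_trans (powR_interp P8 (ltW N0) lam0 _)); first by lra.
by rewrite -!mulrA lerD2l ler_wpM2l ?(ltW lb0).
Qed.

(** The general case follows from that of the truncations [max (f - eps, 0)]:
    they have finite support, and neither their sum nor their variation exceeds
    that of [f]. *)
Lemma critical_bound (gamma alpha q : R) :
  0 <= gamma -> gamma + 1 < d%:R -> 0 <= alpha < 1 ->
  q = d%:R / (d%:R - 1 - gamma + alpha) ->
  exists2 C : R, 0 < C & forall f a b, (forall n, 0 <= f n) ->
    fsums_le f b -> (forall i, translation_le f (delta_mx 0 i) a) ->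
  forall F k, (forall n, n \in F -> 0 < k n)%N -> forall lam, 0 < lam ->
  \sum_(n <- F) ((k n)%:R `^ (- (d%:R - gamma)) * boxsum f n (k n)) `^ q <=
  (C * (lam `^ alpha * a + lam `^ (alpha - 1) * b)) `^ q.
Proof.
move=> g0 gd a01 qE.
have [C C0 HC] := critical_bound_finsupp g0 gd a01 qE.
have q0 : 0 <= q by rewrite qE divr_ge0 //; case/andP: a01 => *; lra.
exists (2 * C) => [|f a b f0 fb fa F k k0 lam lam0]; first by rewrite mulr_gt0.
(* truncating from below at a height which at least halves no value met by the sums *)
have [eps e0 He] : exists2 eps : R, 0 < eps & forall n, n \in F ->
    forall m, m \in box n (k n) -> f m <= 2 * Num.max (f m - eps) 0.
  set Z : {fset 'rV[int]_d} := (\bigcup_(n <- F) box n (k n))%fset.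
  have [eps e0 He] : exists2 eps : R, 0 < eps & forall m, m \in enum_fset Z ->
      f m <= 2 * Num.max (f m - eps) 0.
    elim: (enum_fset Z) => [|m Zs [eps e0 IH]]; first by exists 1.
    have [fm|fm] := eqVneq (f m) 0.
      exists eps => // x; rewrite inE => /predU1P[->|/IH//].
      by rewrite fm mulr_ge0 // le_max lexx orbT.
    have fm0 : 0 < f m by rewrite lt_neqAle eq_sym fm f0.
    exists (Num.min eps (f m / 2)) => [|x]; first by rewrite lt_min e0 divr_gt0.
    rewrite inE => /predU1P[->|/IH H].
      have : f m - f m / 2 <= Num.max (f m - Num.min eps (f m / 2)) 0.
        by rewrite le_max lerB // ge_min lexx orbT.
      lra.
    apply: (le_trans H); rewrite ler_wpM2l // ge_max !le_max lexx orbT andbT.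
    by rewrite lerB // ge_min lexx.
  exists eps => // n nF m mn; apply: He; apply/bigfcupP.
  by exists n; rewrite ?nF.
pose g m := Num.max (f m - eps) 0.
have g0' m : 0 <= g m by rewrite le_max lexx orbT.
have [E0 HE0] := finite_superlevel f0 fb e0.
have gE0 n : g n != 0 -> n \in E0.
  move=> gn; apply: HE0; rewrite ltNge; apply: contra gn => fn.
  by rewrite /g max_r // subr_le0.
have gb : fsums_le g b.
  move=> F'; apply: le_trans (fb F'); apply: ler_sum => n _.
  by rewrite ge_max f0 andbT gerBl ltW.
have ga i : translation_le g (delta_mx 0 i) a.
  move=> F'; apply: le_trans (fa i F'); apply: ler_sum => n _; rewrite /g.
  move: (f _) (f n) => x y; rewrite /Num.max.
  by case: ifP => h1; case: ifP => h2; rewrite ler_norml;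
    have := ler_norm (x - y); have := ler_norm (- (x - y)); rewrite normrN; lra.
have HG := HC g a b E0 g0' gE0 gb ga F k k0 lam lam0.
have -> : 2 * C * (lam `^ alpha * a + lam `^ (alpha - 1) * b) =
  2 * (C * (lam `^ alpha * a + lam `^ (alpha - 1) * b)) by ring.
have b0 := fsums_le_ge0 fb.
have a0' : 0 <= a by have := fa (Ordinal d0) fset0; rewrite big_seq_fset0.
rewrite powRM ?mulr_ge0 ?addr_ge0 ?mulr_ge0 ?powR_ge0 ?(ltW C0) //.
apply: le_trans (ler_wpM2l (powR_ge0 _ _) HG); rewrite mulr_sumr.
apply: ler_fsum => n nF; rewrite -powRM ?mulr_ge0 ?powR_ge0 ?boxsum_ge0 //.
apply: powR_le; rewrite ?mulr_ge0 ?powR_ge0 ?boxsum_ge0 // mulrCA.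
rewrite ler_wpM2l ?powR_ge0 // -boxsumZ; apply: boxsum_le => m mn.
exact: He mn.
Qed.
End CriticalBound.

(** * The subcritical estimate *)

(** The optimal value is [lam = b / a]; if [a] or [b] vanishes, it is approached
    as [lam] tends to infinity or to zero. *)
Lemma powR_interp_opt (R : realType) (Y a b C alpha : R) :
  0 <= a -> 0 <= b -> 0 < C -> 0 <= alpha <= 1 ->
  (forall lam, 0 < lam ->
     Y <= C * (lam `^ alpha * a + lam `^ (alpha - 1) * b)) ->
  Y <= 2 * C * (a `^ (1 - alpha) * b `^ alpha).
Proof.
move=> a0 b0 C0 /andP[al0 al1] HY.
(* a single term of positive weight exponent [t] can be made as small as one likes *)
have small t x : t != 0 -> 0 <= x ->
    (forall lam, 0 < lam -> Y <= C * (lam `^ t * x)) -> Y <= 0.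
  move=> t0 x0 H; rewrite leNgt; apply/negP => Y0.
  have [x00|x00] := eqVneq x 0.
    by have := H 1 ltr01; rewrite x00 !mulr0 leNgt Y0.
  have xp : 0 < x by rewrite lt_neqAle eq_sym x00.
  have CY : 0 < Y / (2 * C * x) by rewrite divr_gt0 // !mulr_gt0.
  have := H ((Y / (2 * C * x)) `^ t^-1); rewrite powR_gt0 // => /(_ isT).
  rewrite -powRrM mulVf // powRr1 ?(ltW CY) //.
  have -> : C * (Y / (2 * C * x) * x) = Y / 2 by field; rewrite x00 gt_eqF.
  lra.
have [a00|a00] := eqVneq a 0.
  have [al|al] := eqVneq alpha 1.
    have := HY 1 ltr01; rewrite a00 al subrr !powRr0 powR1 mulr0 add0r (powRr1 b0) !mul1r.
    by have := mulr_ge0 (ltW C0) b0; lra.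
  apply: (@le_trans _ _ 0); last by rewrite !mulr_ge0 ?powR_ge0 // ltW.
  apply: (small (alpha - 1) b) => //; first by rewrite subr_eq0.
  by move=> lam /HY; rewrite a00 mulr0 add0r.
have ap : 0 < a by rewrite lt_neqAle eq_sym a00.
have [b00|b00] := eqVneq b 0.
  have [al|al] := eqVneq alpha 0.
    have := HY 1 ltr01; rewrite b00 al subr0 !powRr0 (powRr1 a0) mulr0 addr0 mul1r mulr1.
    by have := mulr_ge0 (ltW C0) a0; lra.
  apply: (@le_trans _ _ 0); last by rewrite !mulr_ge0 ?powR_ge0 // ltW.
  apply: (small alpha a) => //.
  by move=> lam /HY; rewrite b00 mulr0 addr0.
have bp : 0 < b by rewrite lt_neqAle eq_sym b00.
have /HY/le_trans : 0 < b / a by rewrite divr_gt0.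
apply; rewrite le_eqVlt; apply/orP; left; apply/eqP.
rewrite !powRM ?invr_ge0 // !powR_invl // !powRB ?a00 ?b00 ?implybT //.
rewrite !powRr1 //; field; rewrite !gt_eqF ?powR_gt0 //.
Qed.

Lemma powR_interp_opt_sum (R : realType) (S a b C alpha q : R) :
  0 <= S -> 1 <= q -> 0 <= a -> 0 <= b -> 0 < C -> 0 <= alpha <= 1 ->
  (forall lam, 0 < lam ->
     S <= (C * (lam `^ alpha * a + lam `^ (alpha - 1) * b)) `^ q) ->
  S <= (2 * C * (a `^ (1 - alpha) * b `^ alpha)) `^ q.
Proof.
move=> S0 q1 a0 b0 C0 al HS; have q0 : 0 < q by lra.
have root x y : 0 <= x -> x <= y `^ q -> 0 <= y -> x `^ q^-1 <= y.
  move=> x0 xy y0.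
  apply: (le_trans (powR_le x0 xy _)); first by rewrite invr_ge0 ltW.
  by rewrite -powRrM divff ?gt_eqF // powRr1.
have -> : S = (S `^ q^-1) `^ q by rewrite -powRrM mulVf ?gt_eqF // powRr1.
apply: powR_le; [exact: powR_ge0| |exact: ltW].
apply: powR_interp_opt => // lam l0; apply: root => //; first exact: HS.
by rewrite mulr_ge0 ?(ltW C0) // addr_ge0 // mulr_ge0 ?powR_ge0.
Qed.

Section Subcritical.
Variables (R : realType) (d : nat).
Hypothesis d0 : (0 < d)%N.
Implicit Types (E F Z : {fset 'rV[int]_d}) (k : 'rV[int]_d -> nat).
Implicit Types (f g w : 'rV[int]_d -> R).

Lemma boxsum_power_bounded (s q : R) : 1 <= q -> 0 <= s -> d%:R < s * q ->
  exists2 C : R, 0 < C & forall f b, (forall n, 0 <= f n) -> fsums_le f b ->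
  forall F k, (forall n, n \in F -> 0 < k n)%N ->
  \sum_(n <- F) ((k n)%:R `^ (- s) * boxsum f n (k n)) `^ q <= (C * b) `^ q.
Proof.
move=> q1 s0 ds; have [C C0 HC] := kernel_sum_bounded d0 ds.
have q0 : 0 < q by lra.
exists (C `^ q^-1) => [|f b f0 fb F k k0]; first by rewrite powR_gt0.
have b0 := fsums_le_ge0 fb.
rewrite powRM ?powR_ge0 // -powRrM mulVf ?gt_eqF // powRr1 ?(ltW C0) //.
apply: boxsum_power_bound => // [|m _]; first exact: ltW.
apply: le_trans (HC m F); rewrite [leRHS](bigID (fun n => m \in box n (k n))) /=.
by rewrite lerDl sumr_ge0 // => n _; exact: powR_ge0.
Qed.

(** Depending on whether the radius [k n] is below or above [lam], the estimate by
    the gradient [g] or that by [f] is used; both then involve the same kernel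
    [k^(- (d - beta + alpha))], which is strictly subcritical for l^q. *)
Lemma subcritical_bound (beta alpha q : R) :
  beta < d%:R -> 0 <= alpha <= 1 -> 1 <= q ->
  d%:R / (d%:R - beta + alpha) < q ->
  exists2 C : R, 0 < C & forall f g a b, (forall n, 0 <= f n) ->
    (forall n, 0 <= g n) -> fsums_le g a -> fsums_le f b ->
  forall F k (D : 'rV[int]_d -> R), (forall n, n \in F -> 0 < k n)%N ->
  (forall n, n \in F ->
    [/\ 0 <= D n, D n <= (k n)%:R `^ (- (d%:R - beta + 1)) * boxsum f n (k n) &
        D n <= (k n)%:R `^ (- (d%:R - beta)) * boxsum g n (k n)]) ->
  forall lam, 0 < lam ->
  \sum_(n <- F) D n `^ q <= (C * (lam `^ alpha * a + lam `^ (alpha - 1) * b)) `^ q.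
Proof.
move=> bd /andP[a0 a1] q1; set s := d%:R - beta + alpha => sq.
have s0 : 0 < s by rewrite /s; lra.
have q0 : 0 < q by lra.
rewrite ltr_pdivrMr // mulrC in sq.
have [C C0 HC] := boxsum_power_bounded q1 (ltW s0) sq.
exists C => // f g a b f0 g0 ga fb F k D k0 HD lam l0.
have a0' := fsums_le_ge0 ga; have b0' := fsums_le_ge0 fb.
have term x c h : 0 < c -> (forall n, 0 <= h n) -> fsums_le h x ->
    \sum_(n <- F) (c * ((k n)%:R `^ (- s) * boxsum h n (k n))) `^ q <=
    (C * (c * x)) `^ q.
  move=> c0 h0 hx; have x0 := fsums_le_ge0 hx.
  rewrite mulrCA powRM ?mulr_ge0 ?(ltW c0) ?(ltW C0) //.
  under eq_bigr do rewrite powRM ?mulr_ge0 ?powR_ge0 ?boxsum_ge0 ?(ltW c0) //.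
  by rewrite -mulr_sumr ler_wpM2l ?powR_ge0 ?HC.
have la0 : 0 < lam `^ alpha by rewrite powR_gt0.
have lb0 : 0 < lam `^ (alpha - 1) by rewrite powR_gt0.
have := fsum_minkowski q1 _ _ _ _ (term _ _ _ la0 g0 ga) (term _ _ _ lb0 f0 fb).
rewrite -mulrDr => H; apply: le_trans (H _ _ _ _); last first.
- by rewrite !mulr_ge0 // ltW.
- by rewrite !mulr_ge0 // ltW.
- by move=> n; rewrite !mulr_ge0 ?powR_ge0 ?boxsum_ge0.
- by move=> n; rewrite !mulr_ge0 ?powR_ge0 ?boxsum_ge0.
apply: ler_fsum => n nF; have [D0 D1 D2] := HD n nF.
apply: powR_le => //; last exact: ltW.
have kp : 0 < (k n)%:R :> R by rewrite ltr0n k0.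
have [kl|lk] := leP (k n)%:R lam.
  apply: ler_wpDr; first by rewrite !mulr_ge0 ?powR_ge0 ?boxsum_ge0.
  apply: (le_trans D2); rewrite mulrA ler_wpM2r ?boxsum_ge0 //.
  have -> : - (d%:R - beta) = alpha + - s by rewrite /s; ring.
  by rewrite powRDp // ler_wpM2r ?powR_ge0 // powR_le // ltW.
apply: ler_wpDl; first by rewrite !mulr_ge0 ?powR_ge0 ?boxsum_ge0.
apply: (le_trans D1); rewrite mulrA ler_wpM2r ?boxsum_ge0 //.
have -> : - (d%:R - beta + 1) = (alpha - 1) + - s by rewrite /s; ring.
rewrite powRDp // ler_wpM2r ?powR_ge0 // -[alpha - 1]opprB.
by apply: powRN_le => //; [exact: ltW|lra].
Qed.
End Subcritical.

(** * Continuity by domination *)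

Lemma powR_small (R : realType) (K q e : R) : 0 <= K -> 0 < q -> 0 < e ->
  exists2 x : R, 0 < x & forall y, 0 <= y -> y <= x -> K * y `^ q <= e.
Proof.
move=> K0 q0 e0; exists ((e / (K + 1)) `^ q^-1) => [|y y0 yx].
  by rewrite powR_gt0 // divr_gt0 //; lra.
have e1 : 0 <= e / (K + 1) by rewrite divr_ge0 ?ltW //; lra.
apply: (@le_trans _ _ (K * (e / (K + 1)))).
  rewrite ler_wpM2l //; apply: le_trans (powR_le y0 yx (ltW q0)) _.
  by rewrite -powRrM mulVf ?gt_eqF // powRr1.
by rewrite mulrA ler_pdivrMr; [nra|lra].
Qed.

Lemma powRN_small (R : realType) (K c e : R) : 0 <= K -> 0 < c -> 0 < e ->
  exists N : nat, K * (N.+1%:R) `^ (- c) <= e.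
Proof.
move=> K0 c0 e0; have [x x0 Hx] := powR_small K0 c0 e0.
exists (Num.truncn x^-1); rewrite powRN -powR_invl ?ler0n //; apply: Hx.
  by rewrite invr_ge0.
by rewrite invf_ple ?posrE ?ltr0n // ltW // truncnS_gt.
Qed.

Section Continuity.
Variables (R : realType) (d : nat).
Hypothesis d0 : (0 < d)%N.
Implicit Types (E F Z : {fset 'rV[int]_d}) (k : 'rV[int]_d -> nat).
Implicit Types (f g w : 'rV[int]_d -> R).

(** [E] almost realizes the supremum of the finite sums of [f]. *)
Lemma fsums_tail f b eta : (forall n, 0 <= f n) -> fsums_le f b -> 0 < eta ->
  exists E, fsums_le (fun n => if n \in E then 0 else f n) eta.
Proof.
move=> f0 fb eta0; pose S := [set x : R | exists F, x = \sum_(n <- F) f n].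
have Ssup : has_sup S.
  split; first by exists 0; exists fset0; rewrite big_seq_fset0.
  by exists b => x [F ->]; exact: fb.
have [x [E ->] HE] := sup_adherent eta0 Ssup.
exists E => F; have HEF : \sum_(n <- (E `|` F)%fset) f n <= sup S.
  by apply: ub_le_sup => //; [case: Ssup|exists (E `|` F)%fset].
have : \sum_(n <- E) f n + \sum_(n <- F) (if n \in E then 0 else f n) <=
    \sum_(n <- (E `|` F)%fset) f n; last by lra.
rewrite (@fsum_mem_cond _ _ E (E `|` F)%fset) => [|n nE]; last by rewrite inE nE.
rewrite [leRHS](bigID (fun n => n \in E)) /= lerD2l [leRHS]big_mkcond /=.
apply: (@le_trans _ _ (\sum_(n <- (E `|` F)%fset) (if n \in E then 0 else f n))).
  apply: fsum_le_sub => n; first by case: ifP.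
  by move=> nF; rewrite inE nF orbT.
by apply: ler_sum => n _; case: (n \in E).
Qed.

Lemma fset_in_box E : exists r, {subset E <= box 0 r}.
Proof.
exists (\max_(n <- E) latnorm n)%N => n nE; rewrite in_box subr0.
by rewrite (big_rem n) //= leq_maxl.
Qed.

(** A box with a centre far from the support has to be large in order to meet it.
    The room in [d < s * q] is shared: one part keeps the kernel summable, the
    other one turns the distance into a small factor. *)
Lemma boxsum_power_far (s q : R) : 1 <= q -> 0 <= s -> d%:R < s * q ->
  forall f b E, (forall n, 0 <= f n) -> fsums_le f b ->
    (forall n, f n != 0 -> n \in E) ->
  forall e, 0 < e -> exists Z, forall F k, (forall n, n \in F -> 0 < k n)%N ->
    (forall n, n \in F -> n \notin Z) ->
    \sum_(n <- F) ((k n)%:R `^ (- s) * boxsum f n (k n)) `^ q <= e.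
Proof.
move=> q1 s0 ds f b E f0 fb fE e e0; have q0 : 0 < q by lra.
pose sigma := (s * q + d%:R) / 2.
have sd : d%:R < sigma by rewrite /sigma; lra.
pose c := s * q - sigma; have c0 : 0 < c by rewrite /c /sigma; lra.
have [C C0 HC] := kernel_sum_bounded d0 sd.
have b0 := fsums_le_ge0 fb.
have [N HN] := @powRN_small R (C * b `^ q) c e
  (mulr_ge0 (ltW C0) (powR_ge0 _ _)) c0 e0.
have [r Hr] := fset_in_box E.
exists (box 0 (r + N)) => F k k0 FZ.
apply: le_trans HN; rewrite mulrAC.
apply: boxsum_power_bound => //.
  by rewrite mulr_ge0 ?powR_ge0 // ltW.
move=> m fm; have mE : m \in box 0 r by apply/Hr/fE; rewrite gt_eqF.
apply: (@le_trans _ _ (\sum_(n <- F) latweight R (n - m) `^ (- sigma) *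
    N.+1%:R `^ (- c))); last first.
  by rewrite -mulr_suml ler_wpM2r ?powR_ge0.
rewrite big_mkcond; apply: ler_fsum => n nF; case: ifP => _; last first.
  by rewrite mulr_ge0 ?powR_ge0.
have -> : - (s * q) = - sigma + - c by rewrite /c; ring.
rewrite powRDp ?latweight_gt0 // ler_wpM2l ?powR_ge0 //.
apply: powRN_le; rewrite ?ltr0n //; last exact: ltW.
rewrite ler_nat leq_max; apply/orP; right.
have := FZ n nF; rewrite in_box subr0 -ltnNge => H1.
have := latnormD (n - m) m; rewrite subrK.
by move: mE; rewrite in_box subr0; lia.
Qed.

(** Pointwise convergence together with a domination by box averages gives
    convergence in l^q: far from the bulk of [f] the dominating averages are
    small, and near it only finitely many points matter. *)
Lemma continuity_of_domination (s q C0 : R) (D : ('rV[int]_d -> R) -> 'rV[int]_d -> R) :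
  1 <= q -> 0 <= s -> d%:R < s * q -> 0 < C0 ->
  (forall h b, fsums_le (fun n => `|h n|) b -> forall n, exists2 r, (0 < r)%N &
     `|D h n| <= C0 * (r%:R `^ (- s) * boxsum (fun m => `|h m|) n r)) ->
  (forall f g b c, fsums_le (fun n => `|f n|) b ->
     fsums_le (fun n => `|g n - f n|) c -> forall n, `|D g n - D f n| <= 2 * c) ->
  forall f b, fsums_le (fun n => `|f n|) b -> forall e, 0 < e ->
  exists2 delta : R, 0 < delta & forall g, fsums_le (fun n => `|g n - f n|) delta ->
    fsums_le (fun n => `|D g n - D f n| `^ q) e.
Proof.
move=> q1 s0 ds C00 HD HC f b fb e e0; have q0 : 0 < q by lra.
have b0 := fsums_le_ge0 fb.
have [C1 C10 HC1] := boxsum_power_bounded d0 q1 s0 ds.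
pose A := 2 `^ q * C0 `^ q * 2 `^ q.
have A0 : 0 < A by rewrite !mulr_gt0 ?powR_gt0.
have KA0 : 0 <= A * C1 `^ q * 2 `^ q by rewrite !mulr_ge0 ?powR_ge0 // ltW.
have e8 : 0 < e / 8 by rewrite divr_gt0.
have [eta eta0 Heta] := powR_small KA0 q0 e8.
have [E HE] := fsums_tail (fun n => normr_ge0 (f n)) fb eta0.
pose f1 n := if n \in E then `|f n| else 0.
have f10 n : 0 <= f1 n by rewrite /f1; case: ifP.
have f1b : fsums_le f1 b.
  by move=> F; apply: le_trans (fb F); apply: ler_sum => n _; rewrite /f1; case: ifP.
have f1E n : f1 n != 0 -> n \in E by rewrite /f1; case: ifP; rewrite ?eqxx.
have eA : 0 < e / 8 / A by rewrite divr_gt0.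
have [Z HZ] := boxsum_power_far q1 s0 ds f10 f1b f1E eA.
have [delta1 delta10 Hdelta1] := powR_small (ler0n R #|` Z|) q0 e8.
pose delta := Num.min eta (delta1 / 2).
have delta0 : 0 < delta by rewrite lt_min eta0 divr_gt0.
exists delta => // g gf F.
have far h : fsums_le (fun n => `|h n - f n|) delta ->
    2 `^ q * (\sum_(n <- F | n \notin Z) `|D h n| `^ q) <= e / 4.
  move=> hf; pose r m := (if m \in E then 0 else `|f m|) + `|h m - f m|.
  (* [|h|] is at most [f1], which is supported in [E], plus [r], which is small in l^1 *)
  have r0 m : 0 <= r m by rewrite /r; case: ifP; rewrite ?addr_ge0.
  have hr m : `|h m| <= f1 m + r m.
    have := ler_normD (f m) (h m - f m); rewrite addrC subrK /f1 /r.
    by case: ifP; lra.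
  have r2 : fsums_le r (2 * eta).
    move=> F'; rewrite /r big_split /= mulr2n mulrDl mul1r lerD ?HE //.
    by apply: (le_trans (hf F')); rewrite ge_min lexx.
  have hb : fsums_le (fun n => `|h n|) (b + 2 * eta).
    move=> F'; apply: (@le_trans _ _ (\sum_(n <- F') (f1 n + r n))).
      by apply: ler_sum.
    by rewrite big_split /= lerD ?f1b ?r2.
  have /choice[k Hk] : forall n, exists j, (0 < j)%N /\
      `|D h n| <= C0 * (j%:R `^ (- s) * boxsum (fun m => `|h m|) n j).
    by move=> n; have [j] := HD h _ hb n; exists j.
  pose F' := [fset n in F | n \notin Z]%fset.
  have Hx : \sum_(n <- F') ((k n)%:R `^ (- s) * boxsum f1 n (k n)) `^ q <= e / 8 / A.
    apply: HZ => n; first by case: (Hk n).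
    by rewrite !inE => /andP[].
  have Hy : \sum_(n <- F') ((k n)%:R `^ (- s) * boxsum r n (k n)) `^ q <=
      (C1 * (2 * eta)) `^ q.
    by apply: HC1 => // n _; case: (Hk n).
  have -> : \sum_(n <- F | n \notin Z) `|D h n| `^ q = \sum_(n <- F') `|D h n| `^ q.
    by rewrite big_fset_condE.
  apply: (@le_trans _ _ (2 `^ q * (\sum_(n <- F') C0 `^ q * (2 `^ q *
     (((k n)%:R `^ (- s) * boxsum f1 n (k n)) `^ q +
      ((k n)%:R `^ (- s) * boxsum r n (k n)) `^ q))))).
    rewrite ler_wpM2l ?powR_ge0 //; apply: ler_sum => n _.
    apply: (@le_trans _ _ ((C0 * ((k n)%:R `^ (- s) * boxsum f1 n (k n) +
        (k n)%:R `^ (- s) * boxsum r n (k n))) `^ q)).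
      apply: powR_le => //; last exact: ltW.
      case: (Hk n) => _ /le_trans; apply; rewrite ler_wpM2l ?(ltW C00) //.
      rewrite -mulrDr ler_wpM2l ?powR_ge0 // -boxsumD.
      by apply: boxsum_le => m _; exact: hr.
    have X0 : 0 <= (k n)%:R `^ (- s) * boxsum f1 n (k n).
      by rewrite mulr_ge0 ?powR_ge0 ?boxsum_ge0.
    have Y0 : 0 <= (k n)%:R `^ (- s) * boxsum r n (k n).
      by rewrite mulr_ge0 ?powR_ge0 ?boxsum_ge0.
    rewrite powRM ?addr_ge0 ?(ltW C00) // ler_wpM2l ?powR_ge0 //.
    by apply: powR_add_le => //; exact: ltW.
  rewrite -mulr_sumr -mulr_sumr !mulrA -/A big_split /=.
  have := ler_wpM2l (ltW A0) (lerD Hx Hy).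
  have := Heta eta (ltW eta0) (lexx _); move: Hx Hy => _ _.
  rewrite !powRM ?mulr_ge0 ?(ltW C10) ?(ltW eta0) // !mulrDr.
  have -> : A * (e / 8 / A) = e / 8 by field; rewrite gt_eqF.
  have -> : A * (C1 `^ q * (2 `^ q * eta `^ q)) = A * C1 `^ q * 2 `^ q * eta `^ q.
    by ring.
  by lra.
rewrite (bigID (fun n => n \in Z)) /=.
have near_ : \sum_(n <- F | n \in Z) `|D g n - D f n| `^ q <= e / 8.
  apply: (@le_trans _ _ (\sum_(n <- Z) (2 * delta) `^ q)).
    apply: (@le_trans _ _ (\sum_(n <- F | n \in Z) (2 * delta) `^ q)).
      apply: ler_sum => n _; apply: powR_le => //; last exact: ltW.
      exact: HC fb gf n.
    rewrite big_fset_condE; apply: fsum_le_sub => n; first exact: powR_ge0.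
    by rewrite !inE => /andP[].
  rewrite big_const_seq count_predT iter_addr_0 -[leLHS]mulr_natl.
  apply: Hdelta1; first by rewrite mulr_ge0 // ltW.
  rewrite mulrC -ler_pdivlMr // /delta ge_min lexx orbT //.
have far_ : \sum_(n <- F | n \notin Z) `|D g n - D f n| `^ q <=
   2 `^ q * (\sum_(n <- F | n \notin Z) `|D g n| `^ q) +
   2 `^ q * (\sum_(n <- F | n \notin Z) `|D f n| `^ q).
  rewrite -mulrDr -big_split /= mulr_sumr; apply: ler_sum => n _.
  apply: le_trans (powR_add_le (normr_ge0 _) (normr_ge0 _) (ltW q0)).
  by apply: powR_le; [|exact: ler_normB|exact: ltW].
have ff : fsums_le (fun n => `|f n - f n|) delta.
  by move=> F'; rewrite big1 ?ltW // => n _; rewrite subrr normr0.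
by have := far g gf; have := far f ff; lra.
Qed.
End Continuity.

(** * Lattice points and the sup norm *)

Section RowNorm.
Variables (R : realType) (d : nat).
Implicit Types (x y : 'rV[R]_d) (m n : 'rV[int]_d).

Lemma row_norm_le x c : 0 <= c -> (forall i, `|x 0 i| <= c) -> `|x| <= c.
Proof.
move=> c0 H; rewrite (_ : `|x| = mx_norm x) // mx_normrE; apply: bigmax_le => // -[i j] _ /=.
by rewrite ord1; exact: H.
Qed.

Lemma row_norm_ge x i : `|x 0 i| <= `|x|.
Proof.
rewrite (_ : `|x| = mx_norm x) // mx_normrE.
exact: (le_bigmax _ (fun i : 'I_1 * 'I_d => `|x i.1 i.2|) (0, i)).
Qed.

Lemma lattice_embedD m n :
  lattice_embed R (m + n) = lattice_embed R m + lattice_embed R n.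
Proof. by apply/rowP => i; rewrite !mxE intrD. Qed.

Lemma lattice_embedB m n :
  lattice_embed R (m - n) = lattice_embed R m - lattice_embed R n.
Proof. by apply/rowP => i; rewrite !mxE intrB. Qed.

Lemma lattice_embedMn m (t : nat) :
  lattice_embed R (m *+ t) = t%:R *: lattice_embed R m.
Proof.
elim: t => [|t IH]; first by rewrite mulr0n scale0r; apply/rowP => i; rewrite !mxE.
by rewrite mulrS lattice_embedD IH -[t.+1]add1n natrD scalerDl scale1r.
Qed.

Lemma lattice_embed_delta i : lattice_embed R (delta_mx 0 i) = delta_mx 0 i :> 'rV_d.
Proof. by apply/rowP => j; rewrite !mxE natz. Qed.

Lemma lattice_embed_norm m : `|lattice_embed R m| = (latnorm m)%:R.
Proof.
have E i : `|lattice_embed R m 0 i| = (absz (m 0 i))%:R.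
  by rewrite mxE -intr_norm -abszE.
apply/le_anti/andP; split.
  apply: row_norm_le => // i; rewrite E ler_nat; exact: latnorm_ge.
apply: (@le_trans _ _ (Num.truncn `|lattice_embed R m|)%:R); last first.
  by rewrite truncn_le.
rewrite ler_nat; apply/latnorm_leP => i.
by rewrite truncn_ge_nat // -E row_norm_ge.
Qed.

Definition lattice_floor x : 'rV[int]_d := map_mx Num.floor x.

Lemma lattice_floor_itv x i : 0 <= x 0 i - lattice_embed R (lattice_floor x) 0 i < 1.
Proof.
rewrite !mxE subr_ge0 ltrBlDr addrC.
by rewrite ge_floor -intrD1 floorD1_gt.
Qed.

Lemma lattice_floor_norm x : `|x - lattice_embed R (lattice_floor x)| <= 1.
Proof.
apply: row_norm_le => // i; have := lattice_floor_itv x i.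
by rewrite !mxE => /andP[h1 h2]; rewrite ger0_norm // ltW.
Qed.

Lemma lattice_near_box (x : 'rV[R]_d) (M : R) m : 0 <= M ->
  `|lattice_embed R m - x| <= M ->
  m \in box (lattice_floor x) (Num.truncn (M + 1)).
Proof.
move=> M0 H; rewrite in_box truncn_ge_nat ?addr_ge0 //.
have : `|lattice_embed R (m - lattice_floor x)| <= M + 1.
  rewrite lattice_embedB.
  have -> : lattice_embed R m - lattice_embed R (lattice_floor x) =
    (lattice_embed R m - x) + (x - lattice_embed R (lattice_floor x)).
    by rewrite addrA subrK.
  by rewrite (le_trans (ler_normD _ _)) // lerD // lattice_floor_norm.
by rewrite lattice_embed_norm.
Qed.

End RowNorm.

(** * Dilates of a convex body *)

Section ConvexBody.
Variables (R : realType) (d : nat).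
Implicit Types (x y u : 'rV[R]_d) (m n w : 'rV[int]_d) (K : set 'rV[R]_d).

(** The set [r K].  Written as an image, it also makes sense for [r = 0], where it
    is the origin alone. *)
Definition dilation K (r : R) : set 'rV[R]_d :=
  [set x | exists2 y, K y & x = r *: y].

(** [K] contains the ball of radius [rho] and lies in the ball of radius [c]
    around the origin, for the sup norm. *)
Definition convex_body K (rho c : R) :=
  [/\ forall x y (t : R), K x -> K y -> 0 <= t <= 1 -> K (t *: x + (1 - t) *: y),
      0 < rho, forall x, `|x| <= rho -> K x, 0 < c & forall x, K x -> `|x| <= c].

Section Body.
Variables (K : set 'rV[R]_d) (rho c : R).
Hypothesis HK : convex_body K rho c.

Lemma dilationD a b x y : 0 <= a -> 0 <= b ->
  dilation K a x -> dilation K b y -> dilation K (a + b) (x + y).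
Proof.
case: HK => Kc _ _ _ _; rewrite le_eqVlt => /predU1P[<-|a0] b0 [x' Kx ->] [y' Ky ->].
  by exists y' => //; rewrite scale0r !add0r.
have ab : 0 < a + b by rewrite ltr_wpDr.
exists (a / (a + b) *: x' + (1 - a / (a + b)) *: y').
  apply: Kc => //; rewrite divr_ge0 ?(ltW a0) ?(ltW ab) //=.
  by rewrite ler_pdivrMr // mul1r lerDl.
rewrite scalerDr !scalerA mulrCA divff ?gt_eqF // mulr1.
rewrite mulrBr mulr1 mulrCA divff ?gt_eqF // mulr1.
by rewrite [a + b]addrC addrK.
Qed.

Lemma dilation_ball r x : 0 <= r -> `|x| <= rho * r -> dilation K r x.
Proof.
case: HK => _ r0 Kb _ _; rewrite le_eqVlt => /predU1P[<-|r1] xr.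
  move: xr; rewrite mulr0 normr_le0 => /eqP ->.
  by exists 0; [apply: Kb; rewrite normr0 ltW|rewrite scaler0].
exists (r^-1 *: x); last by rewrite scalerA divff ?gt_eqF // scale1r.
by apply: Kb; rewrite normrZ gtr0_norm ?invr_gt0 // mulrC ler_pdivrMr.
Qed.

Lemma dilation_norm r x : 0 <= r -> dilation K r x -> `|x| <= c * r.
Proof.
case: HK => _ _ _ _ KC r0 [y /KC yc ->].
by rewrite normrZ ger0_norm // mulrC ler_wpM2r.
Qed.

Lemma dilation0 r : 0 <= r -> dilation K r 0.
Proof.
move=> r0; apply: dilation_ball => //; rewrite normr0 mulr_ge0 //.
by case: HK => _ /ltW.
Qed.

Lemma dilation_le a b x : 0 <= a -> a <= b -> dilation K a x -> dilation K b x.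
Proof.
move=> a0 ab Ka; have := dilationD a0 (_ : 0 <= b - a) Ka (dilation0 (_ : 0 <= b - a)).
by rewrite addr0 (addrC a) subrK; apply; rewrite subr_ge0.
Qed.

Lemma dilationZ a b x : dilation K a x -> dilation K (b * a) (b *: x).
Proof. by case=> y Ky ->; exists y => //; rewrite scalerA. Qed.

(** If [w] is a long lattice vector close to the direction of [x], then a point
    [x] of the annulus between [r K] and [(r + 1) K] leaves [(r + 1) K] at the
    first step along [w].  Indeed, write [w = theta x + u] and let [x + t w] be in
    [(r + 1) K]; as [- t u] is in [(t / rho) K], the point [(1 + t theta) x] is in
    [(r + 1 + t / rho) K], and dividing by [1 + t theta] puts [x] in [r K]. *)
Lemma annulus_exit r x w (t : nat) (L : R) : 1 <= r -> x != 0 ->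
  2 * c * (1 + rho^-1) <= L ->
  `|lattice_embed R w - (L / `|x|) *: x| <= 1 -> (0 < t)%N ->
  dilation K (r + 1) x -> dilation K (r + 1) (x + t%:R *: lattice_embed R w) ->
  dilation K r x.
Proof.
case: (HK) => _ rho0 _ c0 _ r1 x0 HL wx t0 Kx Ky.
have r0 : 0 <= r by lra.
have xn : 0 < `|x| by rewrite normr_gt0.
have tR : 1 <= t%:R :> R by rewrite ler1n.
set theta := L / `|x| in wx.
have th : 1 + rho^-1 <= r * theta.
  have xr : `|x| <= 2 * c * r.
    have := dilation_norm (_ : 0 <= r + 1) Kx; rewrite addr_ge0 // => /(_ isT).
    by have := mulr_ge0 (ltW c0) (_ : 0 <= r - 1); nra.
  rewrite /theta mulrA ler_pdivlMr //.
  have rho1 : 0 < rho^-1 by rewrite invr_gt0.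
  apply: (@le_trans _ _ ((1 + rho^-1) * (2 * c * r))).
    by rewrite ler_wpM2l //; lra.
  have -> : (1 + rho^-1) * (2 * c * r) = r * (2 * c * (1 + rho^-1)) by ring.
  by rewrite ler_wpM2l.
have den : 0 < 1 + t%:R * theta.
  have : 0 < r * theta by apply: lt_le_trans th; rewrite addr_gt0 // invr_gt0.
  rewrite pmulr_rgt0 //; last by lra.
  by move=> h; rewrite addr_gt0 // mulr_gt0 //; lra.
set u := lattice_embed R w - theta *: x in wx.
have Ku : dilation K (t%:R / rho) (- (t%:R *: u)).
  apply: dilation_ball; first by rewrite divr_ge0 // ltW.
  rewrite normrN normrZ ger0_norm // mulrCA divff ?gt_eqF // mulr1.
  by rewrite ler_piMr.
have := dilationD (_ : 0 <= r + 1) (_ : 0 <= t%:R / rho) Ky Ku.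
have -> : x + t%:R *: lattice_embed R w - t%:R *: u = (1 + t%:R * theta) *: x.
  by rewrite /u scalerBr opprB addrACA subrr addr0 scalerDl scale1r scalerA addrC.
rewrite addr_ge0 // divr_ge0 ?(ltW rho0) // => /(_ isT isT).
move=> /(dilationZ (1 + t%:R * theta)^-1).
rewrite scalerA mulVf ?gt_eqF // scale1r; apply: dilation_le.
  by rewrite mulr_ge0 ?invr_ge0 ?(ltW den) // !addr_ge0 // divr_ge0 // ltW.
rewrite ler_pdivrMl //.
have := ler_wpM2l (ler0n R t) th; nra.
Qed.
End Body.
End ConvexBody.

(** * Counting lattice points in dilates *)

Lemma absz_le_nat (z : int) (N : nat) : - N%:Z <= z -> z <= N%:Z ->
  (absz z <= N)%N.
Proof. lia. Qed.

Section LatticeCount.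
Variables (R : realType) (d : nat) (K : set 'rV[R]_d) (rho c : R).
Hypothesis HK : convex_body K rho c.
Implicit Types (x y u : 'rV[R]_d) (m n w : 'rV[int]_d) (F : {fset 'rV[int]_d}).

Definition dilation_points x0 r : {fset 'rV[int]_d} :=
  fset_set [set m | dilation K r (lattice_embed R m - x0)].

Lemma dilation_points_finite x0 r : 0 <= r ->
  finite_set [set m | dilation K r (lattice_embed R m - x0)].
Proof.
move=> r0; have c0 : 0 < c by case: HK.
pose B := box (lattice_floor x0) (Num.truncn (c * r + 1)).
apply: (@sub_finite_set _ _ [set` B]); last exact: finite_fset.
move=> m /= /(dilation_norm HK r0) H; apply: lattice_near_box => //.
by rewrite mulr_ge0 // ltW.
Qed.

Lemma in_dilation_points x0 r m : 0 <= r ->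
  (m \in dilation_points x0 r) <-> dilation K r (lattice_embed R m - x0).
Proof.
move=> r0; rewrite in_fset_set; last exact: dilation_points_finite.
by rewrite inE.
Qed.

Lemma card_near F x0 M : 0 <= M ->
  (forall m, m \in F -> `|lattice_embed R m - x0| <= M) ->
  #|` F|%:R <= (2 * M + 3) ^+ d :> R.
Proof.
move=> M0 HF; set N := Num.truncn (M + 1).
have NM : N%:R <= M + 1 by rewrite truncn_le addr_ge0.
apply: (@le_trans _ _ (N.*2.+1 ^ d)%:R).
  rewrite ler_nat (leq_trans _ (card_box (lattice_floor x0) N)) //.
  by apply/fsubset_leq_card/fsubsetP => m /HF; exact: lattice_near_box.
rewrite natrX lerXn2r ?nnegrE ?ler0n //; first by lra.
by rewrite -natr1 -mul2n natrM; lra.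
Qed.

(** When [rho r >= 1] the dilate contains a cube of lattice points of side of
    order [r], even if its centre is not a lattice point; for smaller [r] the
    presence of one lattice point is enough. *)
Lemma card_dilation_points_ge : exists2 c1 : R, 0 < c1 &
  forall x0 r, 0 <= r -> dilation_points x0 r != fset0 ->
  c1 * (1 + r) ^+ d <= #|` dilation_points x0 r|%:R.
Proof.
have rho0 : 0 < rho by case: HK.
pose c1 := rho / (2 * (1 + rho)).
have c10 : 0 < c1 by rewrite divr_gt0 // mulr_gt0 //; lra.
have c1E : c1 * (2 * (1 + rho)) = rho.
  by rewrite /c1 divfK // gt_eqF // mulr_gt0 //; lra.
exists (c1 ^+ d) => [|x0 r r0 ne]; first exact: exprn_gt0.
rewrite -exprMn; have [r1|r1] := ltP (rho * r) 1.
  apply: (@le_trans _ _ 1); last by rewrite ler1n cardfs_gt0.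
  rewrite exprn_ile1 //; first by rewrite mulr_ge0 ?addr_ge0 // ltW.
  have : c1 * (1 + r) * (2 * (1 + rho)) <= 1 * (2 * (1 + rho)) by nra.
  by rewrite ler_pM2r // mulr_gt0 //; lra.
set L := Num.truncn (rho * r).
have L1 : (1 <= L)%N by rewrite truncn_gt0.
have LR : 1 <= L%:R :> R by rewrite ler1n.
have Lr : L%:R <= rho * r by rewrite truncn_le; lra.
have rL : rho * r <= L%:R + 1 by rewrite natr1 ltW // truncnS_gt.
apply: (@le_trans _ _ (L ^ d)%:R).
  rewrite natrX lerXn2r ?nnegrE ?ler0n //.
    by rewrite mulr_ge0 ?addr_ge0 // ltW.
  have : c1 * (1 + r) * (2 * (1 + rho)) <= L%:R * (2 * (1 + rho)) by nra.
  by rewrite ler_pM2r // mulr_gt0 //; lra.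
pose v (a : {ffun 'I_d -> 'I_L}) : 'rV[int]_d := \row_i (a i : nat)%:Z.
have v_inj : injective (fun a => lattice_floor x0 + v a).
  move=> a b /addrI /rowP ab; apply/ffunP => i; apply/val_inj.
  by have := ab i; rewrite !mxE => -[].
rewrite ler_nat; have := card_imfset imfset_key (mem predT) v_inj.
rewrite /= -cardE card_ffun !card_ord => <-.
apply/fsubset_leq_card/fsubsetP => m /imfsetP[a _ ->].
apply/in_dilation_points => //; apply: (dilation_ball HK r0).
apply: row_norm_le => [|i]; first by rewrite mulr_ge0 // ltW.
have := lattice_floor_itv x0 i; rewrite lattice_embedD !mxE /=.
have aL : (a i)%:R + 1 <= L%:R :> R by rewrite natr1 ler_nat.
have a0 : 0 <= (a i)%:R :> R by rewrite ler0n.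
move=> /andP[h1 h2]; rewrite ler_norml -pmulrn; apply/andP; split; lra.
Qed.

(** Suppose [r >= 1].  From every lattice point [m] of the annulus go [J], about [r], steps along a
    lattice direction [W m] close to that of [m - x0].  By [annulus_exit] the map
    [(m, t) |-> (m + t W m, W m)] is injective; its values lie in a box of radius
    of order [r] times a fixed finite set, so the number of points [m] is
    at most of the order [r^d / r].  For [r < 1] a bounded count is enough. *)
Lemma annulus_card : exists2 C : R, 0 < C & forall x0 r, 0 <= r ->
  #|` (dilation_points x0 (r + 1) `\` dilation_points x0 r)%fset|%:R * (1 + r)
    <= C * (1 + r) ^+ d.
Proof.
have [_ rho0 _ c0 _] := HK.
pose L := Num.bound (2 * c * (1 + rho^-1)).
have HL : 2 * c * (1 + rho^-1) <= L%:R.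
  by rewrite ltW // archi_boundP // !mulr_ge0 ?addr_ge0 ?invr_ge0 // ltW.
pose C1 : R := (2 * (c + L%:R) + 3) ^+ d * (L.*2.+1 ^ d)%:R.
have L0 : 0 <= L%:R :> R by rewrite ler0n.
have C10 : 0 < C1.
  by rewrite mulr_gt0 ?exprn_gt0 ?ltr0n ?expn_gt0 //; lra.
have C20 : 0 < (2 * c + 3) ^+ d by rewrite exprn_gt0 //; lra.
have near r x0 m : 0 <= r -> m \in dilation_points x0 (r + 1) ->
    `|lattice_embed R m - x0| <= c * (1 + r).
  move=> r0 /in_dilation_points; rewrite addr_ge0 // => /(_ isT).
  by rewrite addrC; apply: (dilation_norm HK); rewrite addr_ge0.
have grow (a r : R) : 0 <= a -> 0 <= r -> (2 * (a * (1 + r)) + 3) ^+ d <=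
    (2 * a + 3) ^+ d * (1 + r) ^+ d.
  move=> a0 r0; have ar := mulr_ge0 a0 r0.
  rewrite -exprMn; apply: lerXn2r; rewrite ?nnegrE; lra.
exists (2 * (2 * c + 3) ^+ d + 2 * C1) => [|x0 r r0].
  by rewrite addr_gt0 // mulr_gt0.
set T := (_ `\` _)%fset.
have TA m : m \in T -> m \in dilation_points x0 (r + 1) /\ m \notin dilation_points x0 r.
  by rewrite inE => /andP[].
have r1 : 0 <= 1 + r by rewrite addr_ge0.
have P0 : 0 <= (1 + r) ^+ d by rewrite exprn_ge0.
have [rlt|rge] := ltP r 1.
  have : #|` T|%:R <= (2 * (c * (1 + r)) + 3) ^+ d :> R.
    apply: (@card_near _ x0); first by rewrite mulr_ge0 // ltW.
    by move=> m /TA[mA _]; apply: near.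
  have := grow c r (ltW c0) r0; set X := (2 * c + 3) ^+ d in C20 *.
  set Y := (_ ^+ d); set Q := (1 + r) ^+ d in P0 *; set t := _%:R => h1 h2.
  have t0 : 0 <= t by rewrite ler0n.
  have : t * (1 + r) <= X * Q * 2 by apply: ler_pM => //; lra.
  by have := mulr_ge0 (ltW C10) P0; lra.
pose J := Num.truncn (1 + r).
have Jr : J%:R <= 1 + r by rewrite truncn_le.
have rJ : 1 + r <= J%:R + 1 by rewrite natr1 ltW // truncnS_gt.
pose W m : 'rV[int]_d :=
  lattice_floor ((L%:R / `|lattice_embed R m - x0|) *: (lattice_embed R m - x0)).
pose phi (p : 'rV[int]_d * nat) := (p.1 + W p.1 *+ p.2, W p.1).
have Tne m : m \in T -> lattice_embed R m - x0 != 0.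
  move=> /TA[_]; apply: contraNneq => m0; apply/in_dilation_points => //.
  by rewrite m0; exact: (dilation0 HK).
have Wle m : m \in T -> `|lattice_embed R (W m)| <= L%:R.
  move=> mT; have x0' := Tne m mT; rewrite lattice_embed_norm ler_nat.
  apply/latnorm_leP => i; rewrite mxE.
  set x := lattice_embed R m - x0 in x0' *.
  have xn : 0 < `|x| by rewrite normr_gt0.
  have zL : `|((L%:R / `|x|) *: x) 0 i| <= L%:R.
    apply: le_trans (row_norm_ge _ i) _; rewrite normrZ ger0_norm ?divr_ge0 //.
    by rewrite divfK // gt_eqF.
  move: zL; set z := (_ *: x) 0 i; rewrite ler_norml => /andP[z1 z2].
  have h1 : - L%:Z <= Num.floor z by rewrite floor_ge_int mulrNz.
  have h2 : Num.floor z <= L%:Z by rewrite -(ler_int R) (le_trans (ge_floor _)).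
  exact: absz_le_nat.
pose S := [seq (m, t) | m <- enum_fset T, t <- iota 0 J].
have phi_inj : {in S &, injective phi}.
  have main m t m' t' : m \in T -> m' \in T -> (t < t')%N ->
      m + W m *+ t = m' + W m' *+ t' -> W m = W m' -> False.
    move=> mT m'T tt' e1 e2.
    have [_ /negP m'N] := TA _ m'T; apply: m'N; apply/in_dilation_points => //.
    have [mA _] := TA _ mT; have [m'A _] := TA _ m'T.
    have mE : m = m' + W m' *+ (t' - t).
      by rewrite mulrnBr ?(ltnW tt') // addrA -e1 e2 addrK.
    apply: (@annulus_exit _ _ _ _ _ HK r _ (W m') (t' - t)%N L%:R) => //.
    - exact: Tne.
    - by rewrite distrC; exact: lattice_floor_norm.
    - by rewrite subn_gt0.
    - by apply/in_dilation_points => //; rewrite addr_ge0.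
    - move: mA => /in_dilation_points; rewrite addr_ge0 // => /(_ isT).
      rewrite {1}mE lattice_embedD addrAC; congr (dilation _ _ (_ + _)).
      by rewrite lattice_embedMn.
  move=> p p' /allpairsP[[m t] /= [mT _ ->]].
  move=> /allpairsP[[m' t'] /= [m'T _ ->]] [e1 e2].
  have [lt|lt|tt] := ltngtP t t'.
  - by have := main m t m' t' mT m'T lt e1 e2.
  - by have := main m' t' m t m'T mT lt (esym e1) (esym e2).
  by move: e1; rewrite e2 tt => /addIr ->.
have SS : uniq [seq phi p | p <- S].
  rewrite map_inj_in_uniq //; apply: allpairs_uniq; rewrite ?iota_uniq ?fset_uniq //.
  by move=> [a b] [a' b'].
pose B := [fset p.1 | p in [seq phi p | p <- S]]%fset.
have HB : #|` B|%:R <= (2 * ((c + L%:R) * (1 + r)) + 3) ^+ d :> R.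
  apply: (@card_near _ x0); first by rewrite mulr_ge0 // addr_ge0 // ltW.
  move=> m /imfsetP[_ /= /mapP[_ /allpairsP[[n t] /= [nT tJ ->]] ->] ->] /=.
  have [nA _] := TA _ nT; rewrite lattice_embedD lattice_embedMn addrAC.
  apply: (le_trans (ler_normD _ _)); rewrite mulrDl lerD ?near //.
  rewrite normrZ ger0_norm // mulrC; apply: ler_pM => //; first exact: Wle.
  apply: le_trans Jr; rewrite ler_nat ltnW //.
  by move: tJ; rewrite mem_iota => /andP[].
have HS : (#|` T| * J <= #|` B| * L.*2.+1 ^ d)%N.
  have := uniq_leq_size SS (s2 := [seq (a, b) | a <- enum_fset B, b <- enum_fset (box 0 L)]).
  rewrite size_map !size_allpairs size_iota => H.
  apply: (leq_trans (H _)); last by rewrite leq_mul2l card_box orbT.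
  move=> p pS; apply/allpairsP; exists p; case: p pS => a b pS /=; split=> //.
    by apply/imfsetP; exists (a, b).
  move: pS => /mapP[_ /allpairsP[[n t] /= [nT tJ ->]] [_ ->]].
  by rewrite in_box subr0 -(ler_nat R) -lattice_embed_norm Wle.
have HSR : #|` T|%:R * J%:R <= #|` B|%:R * (L.*2.+1 ^ d)%:R :> R.
  by rewrite -!natrM ler_nat.
have cL : 0 <= c + L%:R by rewrite addr_ge0 // ltW.
have := grow _ r cL r0 => Hg.
have H2 : #|` B|%:R * (L.*2.+1 ^ d)%:R <= C1 * (1 + r) ^+ d.
  rewrite /C1 mulrAC ler_wpM2r ?ler0n //; exact: le_trans Hg.
have J1 : 1 + r <= 2 * J%:R.
  by have : 1 <= J%:R :> R; [rewrite ler1n truncn_gt0; lra|lra].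
have t0 : 0 <= #|` T|%:R :> R by rewrite ler0n.
have := ler_wpM2l t0 J1; have := mulr_ge0 (ltW C20) P0.
set a := _ * (1 + r); lra.
Qed.
End LatticeCount.

(** * Maximal functions over families of dilates *)

Section MaximalPointwise.
Variables (R : realType) (d : nat) (K : set 'rV[R]_d) (rho c beta : R).
Hypothesis d0 : (0 < d)%N.
Hypothesis HK : convex_body K rho c.
Hypothesis Hbeta : 0 <= beta < d%:R.
Implicit Types (x y u : 'rV[R]_d) (m n v w : 'rV[int]_d).
Implicit Types (f g : 'rV[int]_d -> R).

Local Notation eta := (1 - beta / d%:R).
Local Notation points := (dilation_points K).

Lemma mem_points_translate x0 r m v : 0 <= r ->
  (m \in points (x0 + lattice_embed R v) r) = (m - v \in points x0 r).
Proof.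
move=> r0; apply/idP/idP => /(in_dilation_points HK _ _ r0) H;
  apply/(in_dilation_points HK _ _ r0); move: H;
  by rewrite lattice_embedB opprD addrA addrAC.
Qed.

Lemma points_translate x0 r v : 0 <= r ->
  points (x0 + lattice_embed R v) r = [fset (m + v)%R | m in points x0 r]%fset.
Proof.
move=> r0; apply/fsetP => m; rewrite mem_points_translate //.
apply/idP/imfsetP => [H|[m' /= Hm' ->]]; last by rewrite addrK.
by exists (m - v); rewrite ?subrK.
Qed.

Lemma card_points_translate x0 r v : 0 <= r ->
  #|` points (x0 + lattice_embed R v) r| = #|` points x0 r|.
Proof.
move=> r0; rewrite points_translate // card_imfset //=; exact: addIr.
Qed.

Lemma points_subset x0 r : 0 <= r -> {subset points x0 r <= points x0 (r + 1)}.
Proof.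
move=> r0 m /(in_dilation_points HK _ _ r0) H.
apply/(in_dilation_points HK); first by rewrite addr_ge0.
by apply: (dilation_le HK) H; rewrite // lerDl.
Qed.

Definition dilation_average x0 r f : R :=
  (#|` points x0 r|%:R `^ eta)^-1 * \sum_(m <- points x0 r) `|f m|.

(** What the centered and the uncentered maximal functions have in common: the
    dilates used at [n] contain [n], are carried over by lattice translations, and
    are contained, as sets of lattice points, in dilates of radius one more used
    at the neighbours of [n].  The sign of the step is [(-1) ^+ b]. *)
Definition ball_family (P : 'rV[int]_d -> 'rV[R]_d -> R -> Prop) :=
  [/\ forall n, P n (lattice_embed R n) 0,
      forall n x0 r, P n x0 r -> 0 <= r /\ n \in points x0 r,
      forall n x0 r v, P n x0 r -> P (n + v) (x0 + lattice_embed R v) r &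
      forall n x0 r i (b : bool), P n x0 r -> exists2 v,
        P (n + delta_mx 0 i *~ (-1) ^+ b) (x0 + lattice_embed R v) (r + 1) &
        {subset points x0 r <= points (x0 + lattice_embed R v) (r + 1)}].

Variable P : 'rV[int]_d -> 'rV[R]_d -> R -> Prop.
Hypothesis HP : ball_family P.

Definition family_maximal f n : R :=
  sup [set a | exists x0, exists2 r, P n x0 r & a = dilation_average x0 r f].

Lemma eta_ge0 : 0 <= eta.
Proof.
have d0R : 0 < d%:R :> R by rewrite ltr0n.
by case/andP: Hbeta => b0 bd; rewrite subr_ge0 ler_pdivrMr // mul1r ltW.
Qed.

Lemma eta_le1 : eta <= 1.
Proof.
have d0R : 0 < d%:R :> R by rewrite ltr0n.
by case/andP: Hbeta => b0 bd; rewrite gerBl divr_ge0 // ltW.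
Qed.

Lemma eta_d : d%:R * eta = d%:R - beta.
Proof. by rewrite mulrBr mulr1 mulrCA divff ?mulr1 // pnatr_eq0 -lt0n. Qed.

Lemma family_points_ne n x0 r : P n x0 r -> points x0 r != fset0.
Proof. by case: HP => _ H _ _ /H[_ nA]; apply/fset0Pn; exists n. Qed.

Lemma dilation_weight_le1 x0 r : points x0 r != fset0 ->
  0 <= (#|` points x0 r|%:R `^ eta)^-1 <= 1.
Proof.
move=> ne; rewrite invr_ge0 powR_ge0 /= invf_le1.
  by apply: powR_ge1; [rewrite ler1n cardfs_gt0|exact: eta_ge0].
by rewrite powR_gt0 // ltr0n cardfs_gt0.
Qed.

Lemma dilation_average_le n x0 r f b : fsums_le (fun m => `|f m|) b ->
  P n x0 r -> dilation_average x0 r f <= b.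
Proof.
move=> fb /family_points_ne/dilation_weight_le1/andP[w0 w1].
have b0 := fsums_le_ge0 fb.
apply: (@le_trans _ _ (1 * b)); last by rewrite mul1r.
by apply: ler_pM; rewrite ?sumr_ge0.
Qed.

Lemma family_maximal_ge n x0 r f b : fsums_le (fun m => `|f m|) b ->
  P n x0 r -> dilation_average x0 r f <= family_maximal f n.
Proof.
move=> fb HPn; apply: ub_le_sup; last by exists x0, r.
by exists b => _ [x [s Ps ->]]; exact: dilation_average_le Ps.
Qed.

Lemma family_has_sup n f b : fsums_le (fun m => `|f m|) b ->
  has_sup [set a | exists x0, exists2 r, P n x0 r & a = dilation_average x0 r f].
Proof.
move=> fb; split.
  exists (dilation_average (lattice_embed R n) 0 f).
  by exists (lattice_embed R n), 0 => //; case: HP.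
by exists b => _ [x [s Ps ->]]; exact: dilation_average_le Ps.
Qed.

Lemma family_maximal_lipschitz1 f g b b' e n :
  fsums_le (fun m => `|f m|) b -> fsums_le (fun m => `|g m|) b' ->
  fsums_le (fun m => `|g m - f m|) e ->
  family_maximal g n <= family_maximal f n + e.
Proof.
move=> fb gb' ge; apply: ge_sup; first by case: (family_has_sup n gb').
move=> _ [x0 [r Pr ->]].
apply: (@le_trans _ _ (dilation_average x0 r f + e)); last first.
  by rewrite lerD2r; exact: family_maximal_ge fb Pr.
have /andP[w0 w1] := dilation_weight_le1 (family_points_ne Pr).
rewrite /dilation_average -lerBlDl -mulrBr -sumrB.
apply: (@le_trans _ _ (1 * \sum_(m <- points x0 r) `|g m - f m|)); last first.
  by rewrite mul1r; exact: ge.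
apply: (@le_trans _ _ ((#|` points x0 r|%:R `^ eta)^-1 *
   \sum_(m <- points x0 r) `|g m - f m|)).
  by rewrite ler_wpM2l //; apply: ler_sum => m _; exact: lerB_dist.
by rewrite ler_wpM2r // sumr_ge0.
Qed.

Lemma family_maximal_lipschitz f g b e n :
  fsums_le (fun m => `|f m|) b -> fsums_le (fun m => `|g m - f m|) e ->
  `|family_maximal g n - family_maximal f n| <= e.
Proof.
move=> fb gf; have gb : fsums_le (fun m => `|g m|) (b + e).
  move=> F; apply: le_trans (lerD (fb F) (gf F)); rewrite -big_split /=.
  by apply: ler_sum => m _; have := ler_normD (f m) (g m - f m); rewrite subrKC.
have fg : fsums_le (fun m => `|f m - g m|) e.
  by move=> F; under eq_bigr do rewrite distrC; exact: gf.
have h1 := family_maximal_lipschitz1 n fb gb gf.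
have h2 := family_maximal_lipschitz1 n gb fb fg.
by rewrite ler_norml; apply/andP; split; lra.
Qed.

Lemma dilation_weight_bound : exists2 C : R, 0 < C & forall x0 r, 0 <= r ->
  points x0 r != fset0 ->
  (#|` points x0 r|%:R `^ eta)^-1 <= C * (1 + r) `^ (- (d%:R - beta)).
Proof.
have [c1 c10 Hc1] := card_dilation_points_ge HK.
exists (c1 `^ (- eta)) => [|x0 r r0 ne]; first by rewrite powR_gt0.
have r1 : 0 < 1 + r by lra.
rewrite -powRN -eta_d -[- (d%:R * _)]mulrN powRrM -powRM ?powR_ge0 ?(ltW c10) //.
rewrite powR_mulrn ?(ltW r1) //; apply: powRN_le; last exact: eta_ge0.
  by rewrite mulr_gt0 // exprn_gt0.
exact: Hc1.
Qed.

(** Enlarging the dilate increases the sum and, by [annulus_card], the number of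
    lattice points by a fraction of order [1 / (1 + r)] only; as [eta <= 1], the
    weight decreases by at most this fraction. *)
Lemma dilation_average_enlarge : exists2 C : R, 0 < C & forall x0 r v f, 0 <= r ->
  points x0 r != fset0 ->
  {subset points x0 r <= points (x0 + lattice_embed R v) (r + 1)} ->
  dilation_average x0 r f - dilation_average (x0 + lattice_embed R v) (r + 1) f <=
  C * (1 + r) `^ (- (d%:R - beta + 1)) * \sum_(m <- points x0 r) `|f m|.
Proof.
have [C C0 HC] := dilation_weight_bound.
have [c1 c10 Hc1] := card_dilation_points_ge HK.
have [C2 C20 HC2] := annulus_card HK.
exists (C * (C2 / c1)) => [|x0 r v f r0 ne sub]; first by rewrite mulr_gt0 // divr_gt0.
have r1 : 0 < 1 + r by lra.
have r1' : 0 <= r + 1 by lra.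
rewrite /dilation_average card_points_translate //.
set S := \sum_(m <- points x0 r) _; set S' := \sum_(m <- points (x0 + _) _) _.
have S0 : 0 <= S by exact: sumr_ge0.
have SS' : S <= S' by exact: fsum_le_sub.
set N : R := #|` points x0 r|%:R; set N' : R := #|` points x0 (r + 1)|%:R.
have N0 : 0 < N by rewrite ltr0n cardfs_gt0.
have subA : (points x0 r `<=` points x0 (r + 1))%fset.
  by apply/fsubsetP; exact: points_subset.
have NN' : N <= N' by rewrite ler_nat fsubset_leq_card.
have N'0 := lt_le_trans N0 NN'.
have ann : (N' - N) * (1 + r) <= C2 * (1 + r) ^+ d.
  apply: le_trans (HC2 x0 r r0).
  by rewrite cardfsDS // natrB // fsubset_leq_card.
have lowN' : c1 * (1 + r) ^+ d <= N' by apply: le_trans NN'; exact: Hc1.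
have weights : (N' `^ eta)^-1 >= (N `^ eta)^-1 * (N / N').
  have -> : (N' `^ eta)^-1 = (N `^ eta)^-1 * (N / N') `^ eta.
    rewrite powRM ?invr_ge0 ?ltW // powR_invl ?(ltW N'0) // mulrA mulVf ?mul1r //.
    by rewrite gt_eqF // powR_gt0.
  rewrite ler_wpM2l ?invr_ge0 ?powR_ge0 //; apply: ger1_powR; last exact: eta_le1.
  by rewrite divr_gt0 //= ler_pdivrMr // mul1r.
apply: (@le_trans _ _ ((N `^ eta)^-1 * S * ((N' - N) / N'))).
  have w0 : 0 <= (N' `^ eta)^-1 by rewrite invr_ge0 powR_ge0.
  have h1 := ler_wpM2r S0 weights; have h2 := ler_wpM2l w0 SS'.
  have -> : (N `^ eta)^-1 * S * ((N' - N) / N') =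
    (N `^ eta)^-1 * S - (N `^ eta)^-1 * (N / N') * S by field; rewrite !gt_eqF ?powR_gt0.
  by rewrite lerD2l lerN2; exact: le_trans h2.
have frac : (N' - N) / N' <= C2 / c1 * (1 + r)^-1.
  rewrite ler_pdivrMr // mulrAC ler_pdivlMr // mulrAC ler_pdivlMr //.
  apply: (le_trans (ler_wpM2r (ltW c10) ann)); rewrite -mulrA ler_wpM2l ?(ltW C20) //.
  by rewrite mulrC.
have w := HC x0 r r0 ne.
have -> : C * (C2 / c1) * (1 + r) `^ (- (d%:R - beta + 1)) * S =
  (C * (1 + r) `^ (- (d%:R - beta))) * S * (C2 / c1 * (1 + r)^-1).
  by rewrite opprD powRDp // powR_inv1 ?(ltW r1) //; ring.
apply: ler_pM frac; first by rewrite mulr_ge0 ?invr_ge0 ?powR_ge0.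
  by rewrite divr_ge0 ?subr_ge0 // ltW.
by rewrite ler_wpM2r.
Qed.
End MaximalPointwise.

(** * The gradient of a maximal function *)

Section GradientPointwise.
Variables (R : realType) (d : nat) (K : set 'rV[R]_d) (rho c beta : R).
Hypothesis d0 : (0 < d)%N.
Hypothesis HK : convex_body K rho c.
Hypothesis Hbeta : 0 <= beta < d%:R.
Variable P : 'rV[int]_d -> 'rV[R]_d -> R -> Prop.
Hypothesis HP : ball_family K P.
Implicit Types (x y u : 'rV[R]_d) (m n v w : 'rV[int]_d).
Implicit Types (f g : 'rV[int]_d -> R).

Local Notation points := (dilation_points K).
Local Notation average := (dilation_average K beta).
Local Notation maximal := (family_maximal K beta P).

Definition grad_sum f m : R :=
  \sum_(j < d) (`|f (m + delta_mx 0 j) - f m| + `|f (m - delta_mx 0 j) - f m|).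

Lemma grad_sum_ge0 f m : 0 <= grad_sum f m.
Proof. by apply: sumr_ge0 => j _; rewrite addr_ge0. Qed.

Lemma grad_sum_ge f m i (b : bool) :
  `|f (m + delta_mx 0 i *~ (-1) ^+ b) - f m| <= grad_sum f m.
Proof.
rewrite /grad_sum (bigD1 i) //=; apply: ler_wpDr.
  by apply: sumr_ge0 => j _; rewrite addr_ge0.
by case: b; rewrite ?expr1 ?expr0 ?mulrN1z ?mulr1z ?lerDl ?lerDr.
Qed.

(** The first bound compares with the enlarged dilate at the neighbour, which
    gains a power of the radius; the second one with the translated dilate, which
    gains the gradient of [f]. *)
Lemma family_maximal_drop : exists2 C : R, 0 < C & forall f b,
  fsums_le (fun m => `|f m|) b -> forall n x0 r i (s : bool), P n x0 r ->
  let v := delta_mx 0 i *~ (-1) ^+ s in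
  average x0 r f - maximal f (n + v) <=
    C * ((1 + r) `^ (- (d%:R - beta + 1)) * \sum_(m <- points x0 r) `|f m|) /\
  average x0 r f - maximal f (n + v) <=
    C * ((1 + r) `^ (- (d%:R - beta)) * \sum_(m <- points x0 r) grad_sum f m).
Proof.
have [C1 C10 HC1] := dilation_average_enlarge d0 HK Hbeta.
have [C2 C20 HC2] := dilation_weight_bound d0 HK Hbeta.
exists (C1 + C2) => [|f b fb n x0 r i s Pr v]; first by rewrite addr_gt0.
have [_ HPm HPt HPe] := HP; have [r0 nA] := HPm _ _ _ Pr.
have ne := family_points_ne HP Pr.
have pw z : 0 <= (1 + r) `^ z by exact: powR_ge0.
split.
  have [v' Pr' sub] := HPe n x0 r i s Pr.
  have := HC1 x0 r v' f r0 ne sub.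
  have := family_maximal_ge d0 Hbeta HP fb Pr'.
  have : 0 <= C2 * ((1 + r) `^ (- (d%:R - beta + 1)) * \sum_(m <- points x0 r) `|f m|).
    by rewrite !mulr_ge0 ?sumr_ge0 // ltW.
  rewrite -/v mulrDl mulrA; lra.
have Pr' := HPt n x0 r v Pr.
have := family_maximal_ge d0 Hbeta HP fb Pr'.
have G0 : 0 <= \sum_(m <- points x0 r) grad_sum f m.
  by apply: sumr_ge0 => m _; exact: grad_sum_ge0.
have : 0 <= C1 * ((1 + r) `^ (- (d%:R - beta)) * \sum_(m <- points x0 r) grad_sum f m).
  by rewrite !mulr_ge0 // ltW.
have : average x0 r f - average (x0 + lattice_embed R v) r f <=
    C2 * (1 + r) `^ (- (d%:R - beta)) * \sum_(m <- points x0 r) grad_sum f m.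
  rewrite /dilation_average (card_points_translate HK) // (points_translate HK) //.
  rewrite big_imfset /=; last by move=> x y _ _ /addIr.
  rewrite -mulrBr -sumrB.
  apply: (@le_trans _ _ ((#|` points x0 r|%:R `^ (1 - beta / d%:R))^-1 *
     \sum_(m <- points x0 r) grad_sum f m)).
    rewrite ler_wpM2l ?invr_ge0 ?powR_ge0 //; apply: ler_sum => m _.
    apply: le_trans (grad_sum_ge f m i s).
    by rewrite -/v (le_trans (lerB_dist _ _)) // distrC.
  by rewrite ler_wpM2r // HC2.
rewrite mulrDl mulrA; lra.
Qed.

(** A dilate almost attaining the supremum at the end of the edge where the
    maximal function is larger gives both bounds with the same radius [k], as the
    subcritical estimate requires. *)
Lemma family_gradient_bound : exists2 C : R, 0 < C & forall f b,
  fsums_le (fun m => `|f m|) b -> forall n i, exists k : nat,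
  [/\ (0 < k)%N,
      `|maximal f (n + delta_mx 0 i) - maximal f n| <=
        C * (k%:R `^ (- (d%:R - beta + 1)) * boxsum (fun m => `|f m|) n k) &
      `|maximal f (n + delta_mx 0 i) - maximal f n| <=
        C * (k%:R `^ (- (d%:R - beta)) * boxsum (grad_sum f) n k)].
Proof.
have [C C0 HC] := family_maximal_drop.
have [_ rho0 _ c0 _] := HK.
case/andP: (Hbeta) => b0 bd.
pose A := 2 * c + 2; have A0 : 0 < A by rewrite /A; lra.
pose s1 := d%:R - beta + 1; pose s0 := d%:R - beta.
have s10 : 0 <= s1 by rewrite /s1; lra.
have s00 : 0 <= s0 by rewrite /s0; lra.
pose B := A `^ s1 + A `^ s0; have B0 : 0 < B by rewrite addr_gt0 // powR_gt0.
exists (2 * C * B) => [|f b fb n i]; first by rewrite !mulr_gt0.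
have side n1 (s : bool) : 0 < maximal f n1 - maximal f (n1 + delta_mx 0 i *~ (-1) ^+ s) ->
    (latnorm (n1 - n) <= 1)%N -> exists k : nat,
  [/\ (0 < k)%N,
      maximal f n1 - maximal f (n1 + delta_mx 0 i *~ (-1) ^+ s) <=
        2 * C * B * (k%:R `^ (- s1) * boxsum (fun m => `|f m|) n k) &
      maximal f n1 - maximal f (n1 + delta_mx 0 i *~ (-1) ^+ s) <=
        2 * C * B * (k%:R `^ (- s0) * boxsum (grad_sum f) n k)].
  set D := _ - _ => D0 n1n.
  have D20 : 0 < D / 2 by rewrite divr_gt0.
  have [_ [x0 [r Pr ->]] Hav] := sup_adherent D20 (family_has_sup d0 Hbeta HP n1 fb).
  have [_ HPm _ _] := HP; have [r0 nA] := HPm _ _ _ Pr.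
  have r1 : 0 < 1 + r by lra.
  have [H1 H2] := HC f b fb n1 x0 r i s Pr.
  have D2 : D / 2 <= average x0 r f - maximal f (n1 + delta_mx 0 i *~ (-1) ^+ s).
    by move: Hav; rewrite -/(maximal f n1) /D; lra.
  pose k := (Num.truncn (2 * c * r)).+1.
  have kr : k%:R <= A * (1 + r).
    have : (Num.truncn (2 * c * r))%:R <= 2 * c * r by rewrite truncn_le !mulr_ge0 // ltW.
    have := mulr_ge0 (ltW c0) r0.
    by rewrite /k -natr1 /A; lra.
  have kA z : 0 <= z -> (1 + r) `^ (- z) <= A `^ z * k%:R `^ (- z).
    move=> z0; have k0 : 0 < k%:R :> R by rewrite ltr0n.
    have : (A * (1 + r)) `^ (- z) <= k%:R `^ (- z) by apply: powRN_le.
    rewrite powRM ?(ltW A0) ?(ltW r1) // powRN => h.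
    by rewrite -ler_pdivrMl ?powR_gt0.
  have sub : {subset points x0 r <= box n k}.
    move=> m mA; rewrite in_box.
    have m1 : (latnorm (m - n1) <= Num.truncn (2 * c * r))%N.
      rewrite truncn_ge_nat ?mulr_ge0 ?(ltW c0) // -lattice_embed_norm lattice_embedB.
      have h1 : `|lattice_embed R m - x0| <= c * r.
        exact/(dilation_norm HK r0)/(in_dilation_points HK).
      have h2 : `|lattice_embed R n1 - x0| <= c * r.
        exact/(dilation_norm HK r0)/(in_dilation_points HK).
      have := ler_distD x0 (lattice_embed R m) (lattice_embed R n1).
      by rewrite (distrC x0); lra.
    have := latnormD (m - n1) (n1 - n); rewrite subrKA => /leq_trans; apply.
    by rewrite /k -[leqRHS]addn1 leq_add.
  have conv z g : 0 <= z -> (forall m, 0 <= g m) -> A `^ z <= B ->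
      D / 2 <= C * ((1 + r) `^ (- z) * \sum_(m <- points x0 r) g m) ->
      D <= 2 * C * B * (k%:R `^ (- z) * boxsum g n k).
    move=> z0 g0 AB h; have S0 : 0 <= \sum_(m <- points x0 r) g m by exact: sumr_ge0.
    have S1 : \sum_(m <- points x0 r) g m <= boxsum g n k by exact: fsum_le_sub.
    have h1 : (1 + r) `^ (- z) <= B * k%:R `^ (- z).
      by apply: (le_trans (kA z z0)); rewrite ler_wpM2r ?powR_ge0.
    have h2 := ler_pM (powR_ge0 _ _) S0 h1 S1.
    have := ler_wpM2l (ltW C0) h2; rewrite -!mulrA; lra.
  exists k; split=> //.
    apply: conv => //; first by rewrite lerDl powR_ge0.
    exact: le_trans H1.
  apply: conv => //; [exact: grad_sum_ge0|by rewrite lerDr powR_ge0|].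
  exact: le_trans H2.
have [lt|gt|eq_] := ltgtP (maximal f (n + delta_mx 0 i)) (maximal f n).
- rewrite ltr0_norm ?subr_lt0 // opprB.
  have := side n false; rewrite expr0 mulr1z subr_gt0 => /(_ lt); apply.
  by apply/latnorm_leP => j; rewrite subrr mxE.
- rewrite gtr0_norm ?subr_gt0 //.
  have := side (n + delta_mx 0 i) true.
  rewrite expr1 mulrN1z addrK subr_gt0 => /(_ gt); apply.
  rewrite addrAC subrr add0r; apply/latnorm_leP => j; rewrite !mxE.
  by case: (_ && _).
exists 1%N; rewrite eq_ subrr normr0; split=> //;
  rewrite !mulr_ge0 ?powR_ge0 ?boxsum_ge0 ?(ltW C0) ?(ltW B0) //.
exact: grad_sum_ge0.
Qed.
End GradientPointwise.

(** * From finite sums to norms *)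

Section NormBridge.
Variables (R : realType) (d : nat).
Hypothesis d0 : (0 < d)%N.
Implicit Types (m n v w : 'rV[int]_d) (f g : 'rV[int]_d -> R).

Lemma esum_le_fsums g (A : R) : fsums_le g A ->
  (\esum_(n in [set: 'rV[int]_d]) (g n)%:E <= A%:E)%E.
Proof.
move=> gA; apply: ge_ereal_sup => _ [X [finX _] <-].
by rewrite fsbig_finite //= sumEFin lee_fin; exact: gA.
Qed.

Lemma fsums_le_esum g (A : R) :
  (\esum_(n in [set: 'rV[int]_d]) (g n)%:E <= A%:E)%E -> fsums_le g A.
Proof.
move=> H F; rewrite -lee_fin -sumEFin; apply: le_trans H.
apply: ereal_sup_ubound; exists [set` F] => //=.
by rewrite fsbig_finite ?set_fsetK.
Qed.

Lemma lpnorm_le q g (C : R) : 0 < q -> 0 <= C ->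
  fsums_le (fun n => `|g n| `^ q) (C `^ q) -> (lpnorm q g <= C%:E)%E.
Proof.
move=> q0 C0 /esum_le_fsums; rewrite /lpnorm; set S := esum _ _ => H.
have S0 : (0 <= S)%E by apply: esum_ge0 => n _; rewrite lee_fin powR_ge0.
have -> : C%:E = poweR (C `^ q)%:E q^-1.
  by rewrite poweR_EFin -powRrM divff ?gt_eqF // powRr1.
apply: gt0_ler_poweR; rewrite ?invr_ge0 ?(ltW q0) //.
  by rewrite in_itv /= S0 leey.
by rewrite in_itv /= lee_fin powR_ge0 leey.
Qed.

Lemma lpnorm1E g : lpnorm 1 g = (\esum_(n in [set: 'rV[int]_d]) `|g n|%:E)%E.
Proof.
rewrite /lpnorm invr1 poweRe1; last first.
  by apply: esum_ge0 => n _; rewrite lee_fin powR_ge0.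
by apply: eq_esum => n _; rewrite powRr1.
Qed.

Lemma lpnorm1_fin g : (lpnorm 1 g < +oo)%E ->
  exists2 a : R, lpnorm 1 g = a%:E & fsums_le (fun n => `|g n|) a.
Proof.
move=> goo; have g0 : (0 <= lpnorm 1 g)%E by exact: poweR_ge0.
have gfin : lpnorm 1 g \is a fin_num by rewrite ge0_fin_numE.
exists (fine (lpnorm 1 g)); first by rewrite fineK.
by apply: fsums_le_esum; rewrite -lpnorm1E fineK.
Qed.

Lemma lpnorm1_lt g (a : R) : (lpnorm 1 g < a%:E)%E -> fsums_le (fun n => `|g n|) a.
Proof. by move=> ga; apply: fsums_le_esum; rewrite -lpnorm1E ltW. Qed.

Lemma lpnorm1_le g (a : R) : fsums_le (fun n => `|g n|) a -> (lpnorm 1 g <= a%:E)%E.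
Proof. by move=> ga; rewrite lpnorm1E; exact: esum_le_fsums. Qed.

Lemma eucl_norm_ge0 (v : 'rV[R]_d) : 0 <= eucl_norm v.
Proof. exact: sqrtr_ge0. Qed.

Lemma eucl_norm_ge (v : 'rV[R]_d) i : `|v 0 i| <= eucl_norm v.
Proof.
rewrite -sqrtr_sqr; apply: ler_wsqrtr; rewrite (bigD1 i) //= lerDl.
by apply: sumr_ge0 => j _; exact: sqr_ge0.
Qed.

Lemma eucl_norm_powR_le (v : 'rV[R]_d) q : 1 <= q ->
  eucl_norm v `^ q <= (d%:R ^+ 2) `^ q * \sum_i `|v 0 i| `^ q.
Proof.
move=> q1; have q0 : 0 <= q by lra.
have [j _ jmax] : exists2 j : 'I_d, true & forall i, `|v 0 i| <= `|v 0 j|.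
  case: (@arg_maxP _ _ _ (Ordinal d0) xpredT (fun i => `|v 0 i|)) => // j _ H.
  by exists j => // i; exact: H.
have d1 : 1 <= d%:R :> R by rewrite ler1n.
have ev : eucl_norm v <= d%:R ^+ 2 * `|v 0 j|.
  rewrite -[leRHS]ger0_norm ?mulr_ge0 // -sqrtr_sqr; apply: ler_wsqrtr.
  apply: (@le_trans _ _ (\sum_(i < d) `|v 0 j| ^+ 2)).
    by apply: ler_sum => i _; rewrite -[leLHS]real_normK ?num_real // lerXn2r ?nnegrE.
  rewrite sumr_const card_ord -[leLHS]mulr_natl exprMn ler_wpM2r ?exprn_ge0 //.
  rewrite -exprM; exact: ler_eXnr.
apply: (le_trans (powR_le (eucl_norm_ge0 v) ev q0)).
rewrite powRM ?exprn_ge0 // ler_wpM2l ?powR_ge0 //.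
by rewrite (bigD1 j) //= lerDl sumr_ge0 // => i _; exact: powR_ge0.
Qed.

Lemma fsums_le_eucl (G : 'rV[int]_d -> 'rV[R]_d) q e : 1 <= q ->
  (forall i, fsums_le (fun n => `|G n 0 i| `^ q) e) ->
  fsums_le (fun n => `|eucl_norm (G n)| `^ q) ((d%:R ^+ 2) `^ q * (d%:R * e)).
Proof.
move=> q1 HG F.
apply: (@le_trans _ _ (\sum_(n <- F) (d%:R ^+ 2) `^ q * \sum_i `|G n 0 i| `^ q)).
  by apply: ler_sum => n _; rewrite ger0_norm ?eucl_norm_ge0 ?eucl_norm_powR_le.
rewrite -mulr_sumr ler_wpM2l ?powR_ge0 // exchange_big /=.
apply: (@le_trans _ _ (\sum_(i < d) e)); first by apply: ler_sum => i _; exact: HG.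
by rewrite sumr_const card_ord -[leLHS]mulr_natl.
Qed.

Lemma translation_le_l1 f b v : fsums_le (fun n => `|f n|) b ->
  translation_le f v (b + b).
Proof.
move=> fb F; have := lerD (fsums_le_shift v fb F) (fb F); rewrite -big_split /=.
by apply: le_trans; apply: ler_sum => n _; exact: ler_normB.
Qed.

Lemma grad_norm_fin f b : fsums_le (fun n => `|f n|) b ->
  exists2 a : R, lpnormv 1 (dgrad f) = a%:E &
    0 <= a /\ forall i, translation_le f (delta_mx 0 i) a.
Proof.
move=> fb.
have H : forall i, fsums_le (fun n => `|dgrad f n 0 i| `^ 1) (b + b).
  move=> i F; rewrite (eq_bigr (fun n => `|f (n + delta_mx 0 i) - f n|)).
    exact: translation_le_l1.
  by move=> n _; rewrite mxE powRr1.
have := fsums_le_eucl (lexx 1) H; set A := (_ * _) => HA.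
have HA' : fsums_le (fun n => `|eucl_norm (dgrad f n)|) A.
  by move=> F; have := HA F; under eq_bigr do rewrite powRr1 //.
have [|a aE Ha] := @lpnorm1_fin (fun n => eucl_norm (dgrad f n)).
  by apply: le_lt_trans (lpnorm1_le HA') _; rewrite ltry.
exists a => //; split; first exact: fsums_le_ge0 Ha.
move=> i F; apply: le_trans (Ha F); apply: ler_sum => n _.
rewrite [leRHS]ger0_norm ?eucl_norm_ge0 //.
by have := eucl_norm_ge (dgrad f n) i; rewrite mxE.
Qed.

(** Reduction to a bound of each coordinate of the gradient on finite sets; the
    parameter [lam] is optimized afterwards. *)
Lemma grad_bounded_of_interp (T : ('rV[int]_d -> R) -> 'rV[int]_d -> R)
    (alpha q : R) : 1 <= q -> 0 <= alpha <= 1 ->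
  (exists2 C : R, 0 < C & forall f a b, fsums_le (fun n => `|f n|) b ->
     (forall i, translation_le f (delta_mx 0 i) a) ->
     forall i (F : {fset 'rV[int]_d}) lam, 0 < lam ->
     \sum_(n <- F) `|T f (n + delta_mx 0 i) - T f n| `^ q <=
       (C * (lam `^ alpha * a + lam `^ (alpha - 1) * b)) `^ q) ->
  grad_bounded T alpha q.
Proof.
move=> q1 al [C C0 HC]; have q0 : 0 < q by lra.
have dR : 1 <= d%:R :> R by rewrite ler1n.
exists (d%:R ^+ 3 * (2 * C)) => [|f]; first by rewrite !mulr_gt0 ?exprn_gt0 //; lra.
move=> /lpnorm1_fin[b bE fb].
have [a aE [a0 fa]] := grad_norm_fin fb.
have b0 := fsums_le_ge0 fb.
rewrite aE bE !poweR_EFin -!EFinM.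
set X := a `^ _ * b `^ _; have X0 : 0 <= X by rewrite mulr_ge0 ?powR_ge0.
have C2 : 0 <= 2 * C * X by apply: mulr_ge0 => //; apply: mulr_ge0 => //; exact: ltW.
have HX i : fsums_le (fun n => `|dgrad (T f) n 0 i| `^ q) ((2 * C * X) `^ q).
  move=> F; rewrite (eq_bigr (fun n => `|T f (n + delta_mx 0 i) - T f n| `^ q)).
    apply: powR_interp_opt_sum => //.
      by apply: sumr_ge0 => n _; exact: powR_ge0.
    by move=> lam l0; exact: HC.
  by move=> n _; rewrite mxE.
have -> : d%:R ^+ 3 * (2 * C) * X = d%:R ^+ 2 * (d%:R * (2 * C * X)) by ring.
apply: lpnorm_le => //; first by rewrite mulr_ge0 ?exprn_ge0 // mulr_ge0.
move=> F; apply: le_trans (fsums_le_eucl q1 HX F) _.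
rewrite [leRHS]powRM ?exprn_ge0 //; last by rewrite mulr_ge0.
rewrite ler_wpM2l ?powR_ge0 // [leRHS]powRM // ler_wpM2r ?powR_ge0 //.
exact: le1r_powR.
Qed.

Lemma grad_continuous_of_coord (T : ('rV[int]_d -> R) -> 'rV[int]_d -> R) (q : R) :
  1 <= q ->
  (forall i f b, fsums_le (fun n => `|f n|) b -> forall e, 0 < e ->
   exists2 delta : R, 0 < delta & forall g, fsums_le (fun n => `|g n - f n|) delta ->
     fsums_le (fun n => `|(T g (n + delta_mx 0 i) - T g n) -
                          (T f (n + delta_mx 0 i) - T f n)| `^ q) e) ->
  grad_continuous T q.
Proof.
move=> q1 HT f /lpnorm1_fin[b _ fb] eps eps0; have q0 : 0 < q by lra.
have dR : 0 < d%:R :> R by rewrite ltr0n.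
pose D : R := (d%:R ^+ 2) `^ q * d%:R.
have D0 : 0 < D by rewrite mulr_gt0 // powR_gt0 // exprn_gt0.
pose e := (eps / 2) `^ q / D.
have e0 : 0 < e by rewrite divr_gt0 // powR_gt0 // divr_gt0.
have /choice[dl Hdl] : forall i, exists delta : R, 0 < delta /\
   forall g, fsums_le (fun n => `|g n - f n|) delta ->
     fsums_le (fun n => `|(T g (n + delta_mx 0 i) - T g n) -
                          (T f (n + delta_mx 0 i) - T f n)| `^ q) e.
  by move=> i; have [dl dl0 H] := HT i f b fb e e0; exists dl.
pose delta := \big[Num.min/1]_(i < d) dl i.
exists delta => [|g _ /lpnorm1_lt gf].
  rewrite /delta; elim/big_ind: _ => // [x y x0 y0|i _]; first by rewrite lt_min x0.
  by case: (Hdl i).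
have HG i : fsums_le (fun n => `|(dgrad (T g) n - dgrad (T f) n) 0 i| `^ q) e.
  move=> F; have [_ H] := Hdl i.
  have gf' : fsums_le (fun n => `|g n - f n|) (dl i).
    by move=> F'; apply: (le_trans (gf F')); exact: bigmin_le_cond.
  by under eq_bigr do rewrite !mxE; exact: H g gf' F.
have eps2 : 0 < eps / 2 by rewrite divr_gt0.
apply: (@le_lt_trans _ _ (eps / 2)%:E); last by rewrite lte_fin; lra.
apply: lpnorm_le => //; first exact: ltW.
move=> F; apply: le_trans (fsums_le_eucl q1 HG F) _.
by rewrite mulrA -/D /e mulrCA divff ?mulr1 ?gt_eqF.
Qed.
End NormBridge.

(** * The centered and uncentered maximal functions *)

Section ClosureBody.
Variables (R : realType) (d : nat) (Omega : set 'rV[R]_d).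
Hypothesis Omega_bounded : bounded_set Omega.
Hypothesis Omega_convex : convex_set (Omega : set (convex_lmodType 'rV[R]_d)).
Hypothesis Omega_0 : Omega° 0.

Lemma closure_approx (x : 'rV[R]_d) :
  closure Omega x <-> forall e, 0 < e -> exists2 y, Omega y & `|x - y| < e.
Proof.
split=> [H e e0|H B /nbhs_ballP[e /= e0 eB]].
  have [y [Oy xy]] := H _ (nbhsx_ballx x e e0).
  by exists y => //; move: xy; rewrite -ball_normE.
have [y Oy xy] := H e e0; exists y; split=> //.
by apply: eB; rewrite -ball_normE.
Qed.

Lemma closure_convex_body : exists rho c, convex_body (closure Omega) rho c.
Proof.
have /nbhs_ballP[e /= e0 He] : nbhs (0 : 'rV[R]_d) Omega by exact: Omega_0.
have [M M0 HM] := ex_strict_bound_gt0 Omega_bounded.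
exists (e / 2), (M + 1); split.
- move=> x y t /closure_approx Kx /closure_approx Ky /andP[t0 t1].
  apply/closure_approx => a a0.
  have a2 : 0 < a / 2 by rewrite divr_gt0.
  have [x' Ox xx] := Kx _ a2; have [y' Oy yy] := Ky _ a2.
  exists (t *: x' + (1 - t) *: y').
    have := Omega_convex (Itv01 t0 t1) (x := x') (y := y').
    by rewrite !inE; apply.
  have -> : t *: x + (1 - t) *: y - (t *: x' + (1 - t) *: y') =
      t *: (x - x') + (1 - t) *: (y - y').
    by rewrite !scalerBr opprD addrACA.
  apply: (le_lt_trans (ler_normD _ _)); rewrite !normrZ !ger0_norm ?subr_ge0 //.
  have hx : t * `|x - x'| <= `|x - x'| by rewrite ler_piMl.
  have hy : (1 - t) * `|y - y'| <= `|y - y'| by rewrite ler_piMl //; lra.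
  lra.
- by rewrite divr_gt0.
- move=> x xe; apply: subset_closure; apply: He; rewrite -ball_normE /= sub0r normrN.
  by rewrite (le_lt_trans xe) //; lra.
- by lra.
- move=> x /closure_approx /(_ 1 ltr01)[y Oy xy].
  have := HM y Oy; have := ler_normD (x - y) y; rewrite subrK /=; lra.
Qed.
End ClosureBody.

Section Families.
Variables (R : realType) (d : nat) (Omega : set 'rV[R]_d) (rho c beta : R).
Hypothesis d0 : (0 < d)%N.
Hypothesis HK : convex_body (closure Omega) rho c.
Hypothesis HE : forall i : 'I_d,
  closure Omega (delta_mx 0 i) /\ closure Omega (- delta_mx 0 i).
Implicit Types (n m v : 'rV[int]_d) (x y : 'rV[R]_d).

Local Notation K := (closure Omega).

Lemma dilateE x0 r x : dilate Omega x0 r x <-> dilation K r (x - x0).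
Proof.
rewrite /dilate /dilation; case: ifP => [/eqP ->|/negbT r0] /=.
  split=> [->|[y _]]; last by rewrite scale0r => /eqP; rewrite subr_eq0 => /eqP.
  exists 0; last by rewrite subrr scale0r.
  by case: HK => _ r0 H _ _; apply: H; rewrite normr0 ltW.
split=> [Kx|[y Ky ->]]; last by rewrite scalerA mulVf // scale1r.
by exists (r^-1 *: (x - x0)) => //; rewrite scalerA divff // scale1r.
Qed.

Lemma lattice_pointsE x0 r :
  lattice_points Omega x0 r = [set m | dilation K r (lattice_embed R m - x0)].
Proof. by apply/seteqP; split=> m /dilateE. Qed.

Lemma lattice_countE x0 r : lattice_count Omega x0 r = #|` dilation_points K x0 r|.
Proof. by rewrite /lattice_count lattice_pointsE. Qed.

Lemma lattice_sumE x0 r (h : 'rV[int]_d -> R) : 0 <= r ->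
  \sum_(m \in lattice_points Omega x0 r) h m =
  \sum_(m <- dilation_points K x0 r) h m.
Proof.
move=> r0; rewrite fsbig_finite lattice_pointsE //=.
exact: dilation_points_finite HK _ _ r0.
Qed.

Definition centered_family n x0 (r : R) := 0 <= r /\ x0 = lattice_embed R n.

Definition uncentered_family n x0 (r : R) := 0 <= r /\ n \in dilation_points K x0 r.

Lemma centered_maximalE f n :
  centered_maximal Omega beta f n = family_maximal K beta centered_family f n.
Proof.
have E r : 0 <= r ->
    ((lattice_count Omega 0 r)%:R `^ (1 - beta / d%:R))^-1 *
      \sum_(m \in lattice_points Omega 0 r) `|f (n + m)| =
    dilation_average K beta (lattice_embed R n) r f.
  move=> r0; rewrite lattice_countE lattice_sumE // /dilation_average.
  rewrite -[lattice_embed R n]add0r (card_points_translate HK) //.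
  rewrite (points_translate HK) // big_imfset /=; last by move=> x y _ _ /addIr.
  by congr (_ * _); apply: eq_bigr => m _; rewrite addrC.
rewrite /centered_maximal /family_maximal; congr sup; apply/seteqP; split.
  move=> _ [r /= r0 <-]; exists (lattice_embed R n), r => //.
  exact: E.
by move=> _ [_ [r [r0 ->] ->]]; exists r => //; exact: E.
Qed.

Lemma uncentered_maximalE f n :
  uncentered_maximal Omega beta f n = family_maximal K beta uncentered_family f n.
Proof.
rewrite /uncentered_maximal /family_maximal; congr sup; apply/seteqP; split.
  move=> _ [[x0 r] /= [r0 Hn] <-]; exists x0, r.
    split=> //; apply/(in_dilation_points HK) => //; exact/dilateE.
  by rewrite lattice_countE lattice_sumE.
move=> _ [x0 [r [r0 Hn] ->]]; exists (x0, r) => /=.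
  by split=> //; apply/dilateE; exact/(in_dilation_points HK).
by rewrite lattice_countE lattice_sumE.
Qed.

Lemma dilation_unit i (b : bool) :
  dilation K 1 (lattice_embed R (delta_mx 0 i *~ (-1) ^+ b)).
Proof.
case: b; rewrite ?expr1 ?expr0 ?mulrN1z ?mulr1z.
  rewrite -sub0r lattice_embedB lattice_embed_delta.
  exists (- delta_mx 0 i); first by case: (HE i).
  by rewrite scale1r; apply/rowP => j; rewrite !mxE sub0r.
by rewrite lattice_embed_delta; exists (delta_mx 0 i);
  [case: (HE i)|rewrite scale1r].
Qed.

Lemma dilation_unitN i (b : bool) :
  dilation K 1 (- lattice_embed R (delta_mx 0 i *~ (-1) ^+ b)).
Proof.
have -> : - lattice_embed R (delta_mx 0 i *~ (-1) ^+ b) =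
    lattice_embed R (delta_mx 0 i *~ (-1) ^+ (~~ b)).
  by apply/rowP => j; case: b; rewrite /= ?expr1 ?expr0 ?mulrN1z ?mulr1z !mxE
    ?intrN ?opprK.
exact: dilation_unit.
Qed.

Lemma centered_ball_family : ball_family K centered_family.
Proof.
split=> [n|n x0 r [r0 ->]|n x0 r v [r0 ->]|n x0 r i b [r0 ->]] //.
- split=> //; apply/(in_dilation_points HK) => //; rewrite subrr.
  exact: dilation0 HK _ r0.
- by split=> //; rewrite lattice_embedD.
- exists (delta_mx 0 i *~ (-1) ^+ b).
    by split; [rewrite addr_ge0|rewrite lattice_embedD].
  move=> m /(in_dilation_points HK _ _ r0) Hm.
  apply/(in_dilation_points HK); first by rewrite addr_ge0.
  by rewrite opprD addrA; apply: (dilationD HK) => //; exact: dilation_unitN.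
Qed.

Lemma uncentered_ball_family : ball_family K uncentered_family.
Proof.
split=> [n|n x0 r [r0 nA]|n x0 r v [r0 nA]|n x0 r i b [r0 nA]] //.
- split=> //; apply/(in_dilation_points HK) => //; rewrite subrr.
  exact: (dilation0 HK).
- by split=> //; rewrite (mem_points_translate HK) // addrK.
- have e0 : lattice_embed R 0 = 0 :> 'rV[R]_d by apply/rowP => j; rewrite !mxE.
  exists 0; rewrite e0 addr0; last exact: points_subset HK _ _ r0.
  split; first by rewrite addr_ge0.
  apply/(in_dilation_points HK); first by rewrite addr_ge0.
  rewrite lattice_embedD addrAC; apply: (dilationD HK) => //.
    exact/(in_dilation_points HK).
  exact: dilation_unit.
Qed.
End Families.

Section Main.
Variables (R : realType) (d : nat) (K : set 'rV[R]_d) (rho c beta : R).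
Hypothesis d0 : (0 < d)%N.
Hypothesis HK : convex_body K rho c.
Hypothesis Hbeta : 0 <= beta < d%:R.
Variable P : 'rV[int]_d -> 'rV[R]_d -> R -> Prop.
Hypothesis HP : ball_family K P.
Implicit Types (f g : 'rV[int]_d -> R).

Local Notation maximal := (family_maximal K beta P).

Lemma fsums_le_grad_sum f a : (forall i, translation_le f (delta_mx 0 i) a) ->
  fsums_le (grad_sum f) (d%:R * (a + a)).
Proof.
move=> fa F; rewrite /grad_sum exchange_big /=.
apply: (@le_trans _ _ (\sum_(i < d) (a + a))); last first.
  by rewrite sumr_const card_ord -[leLHS]mulr_natl.
apply: ler_sum => i _; rewrite big_split /= lerD ?fa //.
apply: le_trans (fsums_le_shift (- delta_mx 0 i) (fa i) F).
by apply: ler_sum => n _; rewrite subrK distrC.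
Qed.

Lemma maximal_subcritical alpha q : 0 <= alpha <= 1 -> 1 <= q ->
  d%:R / (d%:R - beta + alpha) < q -> grad_bounded maximal alpha q.
Proof.
move=> al q1 dq; have q0 : 0 < q by lra.
apply: grad_bounded_of_interp => //.
have [C C0 HC] := family_gradient_bound d0 HK Hbeta HP.
have bd : beta < d%:R by case/andP: Hbeta.
have [C1 C10 HC1] := subcritical_bound d0 bd al q1 dq.
have d1 : 1 <= d%:R :> R by rewrite ler1n.
exists (C * C1 * (2 * d%:R)) => [|f a b fb fa i F lam l0].
  by rewrite !mulr_gt0 //; lra.
have /choice[k Hk] : forall n, exists k : nat, [/\ (0 < k)%N,
      `|maximal f (n + delta_mx 0 i) - maximal f n| <=
        C * (k%:R `^ (- (d%:R - beta + 1)) * boxsum (fun m => `|f m|) n k) &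
      `|maximal f (n + delta_mx 0 i) - maximal f n| <=
        C * (k%:R `^ (- (d%:R - beta)) * boxsum (grad_sum f) n k)].
  by move=> n; exact: HC.
have a0 : 0 <= a by have := fa i fset0; rewrite big_seq_fset0.
have b0 := fsums_le_ge0 fb.
have := HC1 _ _ _ _ (fun n => normr_ge0 (f n)) (grad_sum_ge0 f)
  (fsums_le_grad_sum fa) fb F k
  (fun n => C^-1 * `|maximal f (n + delta_mx 0 i) - maximal f n|) _ _ lam l0.
set S := \sum_(n <- F) _; set S' := \sum_(n <- F) _ => HS.
have -> : S' = C `^ q * S.
  rewrite mulr_sumr; apply: eq_bigr => n _.
  rewrite -powRM ?(ltW C0) ?mulr_ge0 ?invr_ge0 ?(ltW C0) //.
  by rewrite mulrA divff ?mul1r // gt_eqF.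
have la0 : 0 <= lam `^ alpha by exact: powR_ge0.
have lb0 : 0 <= lam `^ (alpha - 1) by exact: powR_ge0.
apply: (le_trans (ler_wpM2l (powR_ge0 C q) (HS _ _))).
- by move=> n _; case: (Hk n).
- move=> n _; have [k0 h1 h2] := Hk n; split.
  + by rewrite mulr_ge0 // invr_ge0 ltW.
  + by rewrite ler_pdivrMl.
  + by rewrite ler_pdivrMl.
- have A0 : 0 <= lam `^ alpha * (d%:R * (a + a)) by rewrite !mulr_ge0 ?addr_ge0.
  have B0 : 0 <= lam `^ (alpha - 1) * b by rewrite mulr_ge0.
  rewrite -powRM ?(ltW C0) //; last by rewrite mulr_ge0 ?addr_ge0 // ltW.
  apply: powR_le; last exact: ltW.
    by rewrite mulr_ge0 ?(ltW C0) // mulr_ge0 ?(ltW C10) // addr_ge0.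
  rewrite -!mulrA ler_wpM2l ?(ltW C0) // ler_wpM2l ?(ltW C10) //.
  have : lam `^ (alpha - 1) * b <= 2 * d%:R * (lam `^ (alpha - 1) * b).
    by rewrite ler_peMl //; lra.
  lra.
Qed.

(** The box sums of [f] bound the gradient by a fractional maximal function of
    order [beta - 1], and [beta >= 1] makes this order nonnegative. *)
Lemma maximal_critical alpha q : 1 <= beta -> 0 <= alpha < 1 ->
  q = d%:R / (d%:R - beta + alpha) -> grad_bounded maximal alpha q.
Proof.
move=> b1 al qE; have /andP[a0 a1] := al.
have bd : beta < d%:R by case/andP: Hbeta.
have den : 0 < d%:R - beta + alpha by lra.
have q1 : 1 <= q by rewrite qE ler_pdivlMr // mul1r; lra.
apply: grad_bounded_of_interp => //; first by rewrite a0 ltW.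
have [C C0 HC] := family_gradient_bound d0 HK Hbeta HP.
have g0 : 0 <= beta - 1 by rewrite subr_ge0.
have gd : beta - 1 + 1 < d%:R by rewrite subrK.
have qE' : q = d%:R / (d%:R - 1 - (beta - 1) + alpha).
  by rewrite qE; congr (_ / _); ring.
have [C1 C10 HC1] := critical_bound d0 g0 gd al qE'.
exists (C * C1) => [|f a b fb fa i F lam l0]; first by rewrite mulr_gt0.
have /choice[k Hk] : forall n, exists k : nat, (0 < k)%N /\
      `|maximal f (n + delta_mx 0 i) - maximal f n| <=
        C * (k%:R `^ (- (d%:R - (beta - 1))) * boxsum (fun m => `|f m|) n k).
  move=> n; have [k [k0 h _]] := HC f b fb n i; exists k; split=> //.
  by have -> : d%:R - (beta - 1) = d%:R - beta + 1 by ring.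
have fa' j : translation_le (fun n => `|f n|) (delta_mx 0 j) a.
  by move=> F'; apply: le_trans (fa j F'); apply: ler_sum => n _; exact: ler_dist_dist.
have k0 n : n \in F -> (0 < k n)%N by case: (Hk n).
have HS := HC1 _ a b (fun n => normr_ge0 (f n)) fb fa' F k k0 lam l0.
have a0' : 0 <= a by have := fa i fset0; rewrite big_seq_fset0.
have b0 := fsums_le_ge0 fb.
rewrite -mulrA powRM ?(ltW C0) //; last first.
  by rewrite mulr_ge0 ?(ltW C10) // addr_ge0 // mulr_ge0 ?powR_ge0.
apply: le_trans (ler_wpM2l (powR_ge0 C q) HS); rewrite mulr_sumr.
apply: ler_sum => n _; rewrite -powRM ?(ltW C0) ?mulr_ge0 ?powR_ge0 ?boxsum_ge0 //.
by apply: powR_le => //; [case: (Hk n)|lra].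
Qed.

Lemma maximal_continuous q : 1 <= q -> d%:R < (d%:R - beta + 1) * q ->
  grad_continuous maximal q.
Proof.
move=> q1 dq; apply: grad_continuous_of_coord => // i f b fb e e0.
have [C C0 HC] := family_gradient_bound d0 HK Hbeta HP.
have s0 : 0 <= d%:R - beta + 1 by case/andP: Hbeta; lra.
apply: (@continuity_of_domination R d d0 _ q C
  (fun h n => maximal h (n + delta_mx 0 i) - maximal h n) q1 s0 dq C0 _ _
  f b fb e e0).
  by move=> h bh hb n; have [k [k0 h1 _]] := HC h bh hb n i; exists k.
move=> f' g b' e' fb' gf n.
have h1 := family_maximal_lipschitz d0 Hbeta HP (n + delta_mx 0 i) fb' gf.
have h2 := family_maximal_lipschitz d0 Hbeta HP n fb' gf.
set A := maximal g _; set B := maximal g n; set A' := maximal f' _; set B' := maximal f' n.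
have -> : A - B - (A' - B') = (A - A') - (B - B') by ring.
by apply: (le_trans (ler_normB _ _)); have := lerD h1 h2; rewrite -/A -/B -/A' -/B'; lra.
Qed.
End Main.

(** The range of [q] for [alpha = 1], in which continuity is proved, contains both
    the subcritical and the critical ranges. *)
Lemma gradient_exponent (R : realType) (D beta alpha q : R) :
  0 <= alpha <= 1 -> beta < D -> 1 <= q -> D <= (D - beta + alpha) * q ->
  (alpha < 1 \/ D < (D - beta + alpha) * q) -> D < (D - beta + 1) * q.
Proof. by move=> /andP[a0 a1] bD q1 H [h|h]; nra. Qed.

Unset Implicit Arguments.

Theorem theorem3 (R : realType) (d : nat) (hd : (1 <= d)%N)
    (Omega : set 'rV[R]_d)
    (Omega_bounded : bounded_set Omega)
    (Omega_open : open Omega)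
    (Omega_convex : convex_set (Omega : set (convex_lmodType 'rV[R]_d)))
    (Omega_lipschitz : lipschitz_boundary Omega)
    (Omega_0 : Omega° 0)
    (Omega_basis : forall i : 'I_d,
      closure Omega (delta_mx 0 i) /\ closure Omega (- delta_mx 0 i)) :
  (forall alpha beta q : R,
     0 <= beta < d%:R -> 0 <= alpha <= 1 -> 1 <= q ->
     d%:R / (d%:R - beta + alpha) < q ->
     (grad_bounded (centered_maximal Omega beta) alpha q /\
      grad_continuous (centered_maximal Omega beta) q) /\
     (grad_bounded (uncentered_maximal Omega beta) alpha q /\
      grad_continuous (uncentered_maximal Omega beta) q))
  /\
  (forall alpha beta q : R,
     1 <= beta < d%:R -> 0 <= alpha < 1 ->
     q = d%:R / (d%:R - beta + alpha) ->
     (grad_bounded (centered_maximal Omega beta) alpha q /\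
      grad_continuous (centered_maximal Omega beta) q) /\
     (grad_bounded (uncentered_maximal Omega beta) alpha q /\
      grad_continuous (uncentered_maximal Omega beta) q)).
Proof.
have [rho [c HK]] := closure_convex_body Omega_bounded Omega_convex Omega_0.
have cE beta : centered_maximal Omega beta =
    family_maximal (closure Omega) beta (@centered_family R d).
  by apply/funext => f; apply/funext => n; exact: centered_maximalE HK _ _.
have uE beta : uncentered_maximal Omega beta =
    family_maximal (closure Omega) beta (@uncentered_family R d Omega).
  by apply/funext => f; apply/funext => n; exact: uncentered_maximalE HK _ _.
have cF := centered_ball_family HK Omega_basis.
have uF := uncentered_ball_family HK Omega_basis.
split=> alpha beta q Hb Ha.
  move=> q1 dq; have /andP[a0 a1] := Ha; have /andP[b0 bd] := Hb.
  have dq' : d%:R < (d%:R - beta + 1) * q.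
    have : d%:R < (d%:R - beta + alpha) * q.
      by rewrite mulrC -ltr_pdivrMr //; lra.
    by move=> h; apply: (gradient_exponent Ha) => //; [exact: ltW|right].
  rewrite cE uE; split; split.
  - exact: (maximal_subcritical hd HK Hb cF Ha q1 dq).
  - exact: (maximal_continuous hd HK Hb cF q1 dq').
  - exact: (maximal_subcritical hd HK Hb uF Ha q1 dq).
  - exact: (maximal_continuous hd HK Hb uF q1 dq').
move=> qE; have /andP[a0 a1] := Ha; have /andP[b1 bd] := Hb.
have Hb' : 0 <= beta < d%:R by rewrite bd andbT; lra.
have den : 0 < d%:R - beta + alpha by lra.
have q1 : 1 <= q by rewrite qE ler_pdivlMr // mul1r; lra.
have dq' : d%:R < (d%:R - beta + 1) * q.
  apply: (@gradient_exponent _ _ _ alpha) => //; [by lra| |by left].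
  by rewrite qE mulrC divfK // gt_eqF.
rewrite cE uE; split; split.
- exact: (maximal_critical hd HK Hb' cF b1 Ha qE).
- exact: (maximal_continuous hd HK Hb' cF q1 dq').
- exact: (maximal_critical hd HK Hb' uF b1 Ha qE).
- exact: (maximal_continuous hd HK Hb' uF q1 dq').
Qed.
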